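(* Let $G$ be a $d$-regular graph of order $n$, with $d\ge 4$. Then there exists a spanning subgraph $H\subseteq G$ such that every connected component of $H$ is either a cycle or a cubic (3-regular) graph, and \[ f_o(L(G))\ge \frac{n}{2}-\frac{C_5(H)}{2}, \] where $C_5(H)$ is the number of components of $H$ isomorphic to $C_5$.
   Context: All graphs are finite and simple. An induced subgraph of a graph is called odd if every vertex of it has odd degree in it. $f_o(G)$ denotes the maximum order of an odd induced subgraph of $G$. $L(G)$ is the line graph of $G$. *)

(* Defs.v *)
From mathcomp Require Import all_boot all_order all_algebra.
Set Implicit Arguments. Unset Strict Implicit. Unset Printing Implicit Defensive.

Definition simple_graph (T : finType) (e : rel T) :=
  symmetric e /\ irreflexive e.

Definition nbhd (T : finType) (e : rel T) (v : T) : {set T} := [set u | e v u].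
Definition deg (T : finType) (e : rel T) (v : T) : nat := #|nbhd e v|.

Definition odd_induced (T : finType) (e : rel T) (S : {set T}) : bool :=
  [forall v in S, odd #|[set u in S | e v u]|].

(* f_o(G): maximum order of an odd induced subgraph (the empty one is odd). *)
Definition f_o (T : finType) (e : rel T) : nat :=
  \max_(S : {set T} | odd_induced e S) #|S|.

Definition edges (T : finType) (e : rel T) : {set {set T}} :=
  [set [set x; y] | x in T, y in T & e x y].

Definition line_vert (T : finType) (e : rel T) := {A : {set T} | A \in edges e}.

Definition line_rel (T : finType) (e : rel T) : rel (line_vert e) :=
  fun a b => (val a != val b) && (val a :&: val b != set0).

Definition components (T : finType) (h : rel T) : {set {set T}} :=
  [set [set y | connect h x y] | x : T].

(* A component C of h is a cycle (connected 2-regular) / cubic (3-regular). *)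
Definition cycle_comp (T : finType) (h : rel T) (C : {set T}) : bool :=
  [forall v in C, deg h v == 2].
Definition cubic_comp (T : finType) (h : rel T) (C : {set T}) : bool :=
  [forall v in C, deg h v == 3].

(* C_5(H): number of components of H isomorphic to C_5,
   i.e. cycle components with exactly 5 vertices. *)
Definition C5 (T : finType) (h : rel T) : nat :=
  #|[set C in components h | cycle_comp h C && (#|C| == 5)]|.

(* Main.v *)
Require Import Defs.
From mathcomp Require Import all_boot all_order all_algebra.
From mathcomp Require Import zify.
Import Order.TTheory GRing.Theory Num.Theory.
Set Implicit Arguments. Unset Strict Implicit. Unset Printing Implicit Defensive.

(** The two requirements on H decouple: every H with cycle and cubic components
    works, because f_o(L(G)) >= n/2 already holds.

    Existence of H.  For even d a 2-factor exists.  For odd d, we look for a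
    spanning subgraph whose components are regular of degree 2 or d-2, and
    induct on d.  Let the leaves be the minimal vertex sets left by exactly one
    edge, and let W be the rest.  The fractional 2-factor 2/d, Tutte's theorem
    applied to a gadget graph, and the absence of proper one-edge cuts give a
    2-factor of each leaf, and a subgraph F of degree 2 at each vertex of W
    using some of the edges that leave W.  Keep the complement of F on W and on
    the leaves whose outgoing edge ends in W and is not in F, and the 2-factor
    on the other leaves.

    The bound.  A set of edges is an odd induced subgraph of L(G) when each of
    them joins a vertex of odd degree to one of even degree (degrees counted in
    the set), as in K_{1,2k} and K_{2,3}.  In a packing of copies of these with
    the largest number of edges, every uncovered vertex has at most one
    uncovered neighbour; discharging the uncovered vertices onto the blocks
    shows that the blocks have at least n/2 edges. *)

(** * Matchings *)

(** The obstacle for odd [d] is bridges, which can exclude every 2-factor. A leaf is the right unit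
    to cut off because it is flexible: its 2-factor avoids the outgoing edge, while the complement
    of that 2-factor contains it. Hence [F] may use or omit any edge leaving [W]: an edge it uses is
    discarded and the leaf behind it keeps degree 2; an edge it omits survives, and the leaf behind
    it takes degree [d - 2] like [W].

    In the line graph only the chosen edges count, so the stars and the K_{2,3} of the packing may
    be taken as plain, not induced, subgraphs of [G]. The discharging has little slack at [d = 4]: a
    path with two edges can pay for a single uncovered vertex, yet it may have four edges to
    uncovered vertices. The two loads [d - 1] and [d] and the bonus for triangles are tuned to this
    configuration. *)

Section Hall.
Variables I J : finType.
Implicit Types (r : I -> J -> bool) (S : {set I}).

Definition joint_nbhd r S : {set J} := [set j | [exists i in S, r i j]].

Lemma joint_nbhdP r S j :
  reflect (exists2 i, i \in S & r i j) (j \in joint_nbhd r S).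
Proof. by rewrite inE; apply: exists_inP. Qed.

(** Induction on [#|S|]. Without a critical subset, one element may take any of its neighbours; a
    critical subset is matched into its own neighbourhood, and the rest of [S] outside it. [j0] is
    the value of [f] when [S] is empty. *)
Theorem hall (j0 : J) r S :
  (forall S', S' \subset S -> #|S'| <= #|joint_nbhd r S'|) ->
  exists f : I -> J, {in S &, injective f} /\ {in S, forall i, r i (f i)}.
Proof.
have [n] := ubnP #|S|; elim: n r S => // n IHn r S ltSn hallS.
have [->|[i0 Si0]] := set_0Vmem S.
  by exists (fun=> j0); split=> i; rewrite inE.
pose crit S' := [&& S' \proper S, S' != set0 & #|joint_nbhd r S'| <= #|S'|].
have [S1 /and3P[S1S S1n0 S1crit]|nocrit] := pickP crit; last first.
  have /card_gt0P[j1 /joint_nbhdP[i]] : 0 < #|joint_nbhd r [set i0]|.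
    by have := hallS [set i0]; rewrite sub1set Si0 cards1; apply.
  rewrite inE => /eqP-> ri0j1.
  pose r' i j := r i j && (j != j1).
  have [||f [injf rf]] := IHn r' (S :\ i0).
  - by rewrite -ltnS (leq_trans _ ltSn) // (cardsD1 i0 S) Si0 add1n.
  - move=> S' sS'; have [->|S'n0] := eqVneq S' set0; first by rewrite cards0.
    have S'S : S' \proper S by apply: sub_proper_trans sS' (properD1 Si0).
    have := nocrit S'; rewrite /crit S'S S'n0 /= => /negbT; rewrite -ltnNge => lt.
    rewrite -ltnS (leq_trans lt) //.
    rewrite (cardsD1 j1) -add1n leq_add ?leq_b1 // subset_leq_card //.
    apply/subsetP=> j /setD1P[nj /joint_nbhdP[i' Si' rj]].
    by apply/joint_nbhdP; exists i'; rewrite // /r' rj nj.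
  exists (fun i => if i == i0 then j1 else f i); split=> [i1 i2 Si1 Si2|i1 Si1].
    case: eqP => [->|/eqP n1]; case: eqP => [->|/eqP n2] //.
    - have /rf/andP[_ /eqP nf] : i2 \in S :\ i0 by rewrite !inE n2.
      by move=> E; case: nf.
    - have /rf/andP[_ /eqP nf] : i1 \in S :\ i0 by rewrite !inE n1.
      by move=> E; case: nf.
    by apply: injf; rewrite !inE ?n1 ?n2.
  case: eqP => [->|/eqP n1] //.
  by have /rf/andP[] : i1 \in S :\ i0 by rewrite !inE n1.
have sS1 := proper_sub S1S.
have [||f1 [inj1 rf1]] := IHn r S1.
- by rewrite (leq_trans (proper_card S1S)).
- by move=> S' sS'; apply: hallS; apply: subset_trans sS1.
pose r' i j := r i j && (j \notin joint_nbhd r S1).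
have [||f2 [inj2 rf2]] := IHn r' (S :\: S1).
- rewrite -ltnS (leq_trans _ ltSn) // ltnS proper_card //.
  rewrite properE subsetDl /=; apply/subsetPn.
  have [i Si] := set0Pn _ S1n0; exists i; first exact: (subsetP sS1).
  by rewrite !inE Si.
- move=> S' sS'; have := hallS (S' :|: S1).
  rewrite subUset sS1 andbT (subset_trans sS') ?subsetDl // => /(_ isT).
  have dS : [disjoint S' & S1].
    by rewrite disjoint_sym disjoints_subset; apply/subsetP=> i Si; rewrite inE;
       apply/negP=> /(subsetP sS'); rewrite inE Si.
  have -> : #|S' :|: S1| = #|S'| + #|S1| by rewrite cardsU (disjoint_setI0 dS) cards0 subn0.
  have : #|joint_nbhd r (S' :|: S1)| <= #|joint_nbhd r' S'| + #|joint_nbhd r S1|.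
    rewrite -[X in _ <= X + _]addn0.
    apply: leq_trans (leq_subr #|joint_nbhd r' S' :&: joint_nbhd r S1| _).
    rewrite addn0 -cardsU subset_leq_card //.
    apply/subsetP=> j /joint_nbhdP[i Si rij]; rewrite inE.
    case jN : (j \in joint_nbhd r S1); first by rewrite orbT.
    rewrite orbF; apply/joint_nbhdP; exists i; last by rewrite /r' rij jN.
    move: Si; rewrite inE => /orP[//|Si].
    by move/negP: jN; case; apply/joint_nbhdP; exists i.
  by lia.
exists (fun i => if i \in S1 then f1 i else f2 i); split=> [i1 i2 Si1 Si2|i1 Si1].
  case: ifP => n1; case: ifP => n2 E.
  - exact: inj1.
  - have /rf2/andP[_ /negP[]] : i2 \in S :\: S1 by rewrite !inE n2.
    by rewrite -E; apply/joint_nbhdP; exists i1; rewrite ?rf1.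
  - have /rf2/andP[_ /negP[]] : i1 \in S :\: S1 by rewrite !inE n1.
    by rewrite E; apply/joint_nbhdP; exists i2; rewrite ?rf1.
  by apply: inj2; rewrite ?inE ?n1 ?n2.
case: ifP => n1; first exact: rf1.
by have /rf2/andP[] : i1 \in S :\: S1 by rewrite !inE n1.
Qed.
End Hall.

(** * Tutte's theorem in terms of barriers *)

Section Tutte.
Variables (T : finType) (e : rel T).
Hypothesis (eC : symmetric e) (e0 : irreflexive e).
Implicit Types (A B C X : {set T}) (CC : {set {set T}}).

Definition closed_in B C := [forall x in C, forall y in B, e x y ==> (y \in C)].

Lemma closed_inP B C :
  reflect (forall x y, x \in C -> y \in B -> e x y -> y \in C) (closed_in B C).
Proof.
apply: (iffP forall_inP) => [cl x y Cx By exy | cl x Cx].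
  by have /forall_inP/(_ y By)/implyP := cl x Cx; apply.
by apply/forall_inP=> y By; apply/implyP; apply: cl.
Qed.

(* Instead of the odd components of A - X, a barrier has any disjoint odd unions of
   components, which spares all reasoning about connectivity. *)
Definition barrier A X CC :=
  [&& X \subset A, trivIset CC &
      [forall C in CC, [&& odd #|C|, C \subset A :\: X & closed_in (A :\: X) C]]].

Definition perfectly_matched A := exists m : T -> T,
  {in A, forall x, [/\ m x \in A, m (m x) = x & e x (m x)]}.

Lemma barrierP A X CC :
  reflect [/\ X \subset A, trivIset CC &
      forall C, C \in CC -> [/\ odd #|C|, C \subset A :\: X & closed_in (A :\: X) C]]
    (barrier A X CC).
Proof.
apply: (iffP and3P) => [] [-> tCC odC]; split=> //.
  by move=> C CCC; have /forall_inP/(_ C CCC)/and3P := odC.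
by apply/forall_inP=> C /odC/and3P.
Qed.

Lemma odd_cover CC :
  trivIset CC -> (forall C, C \in CC -> odd #|C|) -> odd #|cover CC| = odd #|CC|.
Proof.
move=> tCC odC; rewrite -(eqP tCC) -sum1_card.
apply: (big_ind2 (fun m n => odd m = odd n)) => // m1 n1 m2 n2 E1 E2.
by rewrite !oddD E1 E2.
Qed.

Section Rest.
Variables (A X : {set T}) (CC : {set {set T}}).
Hypothesis bar : barrier A X CC.
Let B := A :\: X :\: cover CC.

Lemma barrier_cover_sub : cover CC \subset A :\: X.
Proof. by case/barrierP: bar => _ _ CCP; apply/bigcupsP=> C /CCP[]. Qed.

Lemma barrier_rest_odd : odd #|B| = odd #|A| (+) odd #|X| (+) odd #|CC|.
Proof.
case/barrierP: bar => XA tCC CCP; have cA := barrier_cover_sub.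
rewrite -odd_cover //; last by move=> C /CCP[].
have := cardsID X A; have := cardsID (cover CC) (A :\: X).
by rewrite (setIidPr XA) (setIidPr cA) => <- <-; rewrite !oddD -/B; do 3!case: odd.
Qed.

Lemma barrier_rest_closed : closed_in (A :\: X) B.
Proof.
case/barrierP: bar => XA tCC CCP; apply/closed_inP=> x y Bx Ay exy.
rewrite inE Ay andbT; apply/bigcupP=> -[C CCC Cy].
have [_ _ /closed_inP clC] := CCP _ CCC.
move: Bx; rewrite inE => /andP[/bigcupP nx Ax]; case: nx; exists C => //.
by apply: (clC y); rewrite // eC.
Qed.

Lemma barrier_add_rest : odd #|B| -> barrier A X (B |: CC) /\ #|B |: CC| = #|CC|.+1.
Proof.
case/barrierP: bar => XA tCC CCP oB.
have dB C : C \in CC -> [disjoint B & C].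
  move=> CCC; rewrite disjoint_subset; apply/subsetP=> x.
  by rewrite !inE => /andP[/bigcupP nc _]; apply/negP=> Cx; apply: nc; exists C.
have nB : B \notin CC.
  apply/negP=> /dB; rewrite -setI_eq0 setIid => /eqP B0.
  by rewrite B0 cards0 in oB.
split; last by rewrite cardsU1 nB.
apply/barrierP; split=> //.
  apply/trivIsetP=> C1 C2; rewrite !inE => /predU1P[->|C1C] /predU1P[->|C2C] //.
  - by rewrite eqxx.
  - by rewrite dB.
  - by rewrite disjoint_sym dB.
  by move/trivIsetP: tCC; apply.
move=> C; rewrite in_setU1.
by case/predU1P=> [->|/CCP//]; split; [| exact: subsetDl | exact: barrier_rest_closed].
Qed.
End Rest.

Definition tutte_condition A := forall X CC, barrier A X CC -> #|CC| <= #|X|.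

(** Parity gains one: if [#|CC|] were [#|X|.+1], the rest would have odd order and could join [CC],
    giving a barrier with [#|X|.+2] sets. *)
Lemma tutte_condition_weaken A : ~~ odd #|A| ->
  (forall X CC, barrier A X CC -> #|CC| <= #|X|.+1) -> tutte_condition A.
Proof.
move=> oA leCC X CC bar; rewrite -ltnS ltn_neqAle leCC // andbT.
apply/eqP=> E; have oB : odd #|A :\: X :\: cover CC|.
  by rewrite barrier_rest_odd // E /= (negbTE oA); case: odd.
have [bar' E'] := barrier_add_rest bar oB.
by have := leCC _ _ bar'; rewrite E' E ltnn.
Qed.

Lemma perfectly_matchedU A B : [disjoint A & B] ->
  perfectly_matched A -> perfectly_matched B -> perfectly_matched (A :|: B).
Proof.
move=> dAB [mA mAP] [mB mBP]; exists (fun x => if x \in A then mA x else mB x) => x.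
have dB y : y \in B -> y \notin A.
  by move=> By; apply/negP=> Ay; rewrite (disjointFr dAB Ay) in By.
rewrite inE => /orP[Ax|Bx].
  by have [mx mmx ex] := mAP x Ax; rewrite Ax inE mx mmx.
have [mx mmx ex] := mBP x Bx.
by rewrite (negbTE (dB _ Bx)) (negbTE (dB _ mx)) inE mx orbT mmx.
Qed.

Lemma perfectly_matched0 : perfectly_matched set0.
Proof. by exists id => x; rewrite inE. Qed.

Lemma perfectly_matched2 x y : e x y -> perfectly_matched [set x; y].
Proof.
move=> exy; have nxy : y != x by apply: contraTneq exy => ->; rewrite e0.
exists (fun z => if z == x then y else x) => z; rewrite !inE.
case/orP=> /eqP->; rewrite ?eqxx (negbTE nxy) ?eqxx ?orbT //=; split=> //.
by rewrite eC.
Qed.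

Lemma perfectly_matched_bigcup (I : finType) (P : {set I}) (F : I -> {set T}) :
  {in P &, forall i j, i != j -> [disjoint F i & F j]} ->
  {in P, forall i, perfectly_matched (F i)} ->
  perfectly_matched (\bigcup_(i in P) F i).
Proof.
have [n] := ubnP #|P|; elim: n P => // n IHn P ltP dF mF.
have [->|[i Pi]] := set_0Vmem P.
  by rewrite big_set0; apply: perfectly_matched0.
rewrite (big_setD1 i) //=; apply: perfectly_matchedU; last first.
- apply: IHn => [|j k /setD1P[_ Pj] /setD1P[_ Pk]|j /setD1P[_ Pj]].
  + by rewrite (cardsD1 i) Pi in ltP.
  + exact: dF.
  exact: mF.
- exact: mF.
apply: bigcup_disjoint => j /setD1P[nji Pj].
by apply: dF; rewrite // eq_sym.
Qed.

(* A barrier with as many odd sets as deleted vertices, with the largest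
   possible deleted set, splits the matching problem: each of its sets is matched
   to one deleted vertex by Hall's theorem, and has a perfect matching after
   removal of any vertex. *)
Theorem tutte A : tutte_condition A -> perfectly_matched A.
Proof.
have [n] := ubnP #|A|; elim: n A => // n IHn A ltA tA.
have [->|[a Aa]] := set_0Vmem A; first exact: perfectly_matched0.
pose tight (p : {set T} * {set {set T}}) :=
  barrier A p.1 p.2 && (#|p.2| == #|p.1|).
have t0 : tight (set0, set0).
  rewrite /tight !cards0 eqxx andbT; apply/barrierP; split; rewrite ?sub0set //=.
    by apply/trivIsetP=> C1 C2; rewrite inE.
  by move=> C; rewrite inE.
case: (arg_maxnP (fun p : {set T} * {set {set T}} => #|p.1|) t0) => -[X CC].
rewrite /tight /= => /andP[bar /eqP cCC] maxX.
have {}maxX X' CC' : barrier A X' CC' -> #|X'| <= #|CC'| -> #|X'| <= #|X|.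
  move=> bar' leCC; apply: (maxX (X', CC')).
  by rewrite bar' eqn_leq leCC andbT (tA _ _ bar').
have evA : ~~ odd #|A|.
  apply/negP=> oA; suff /tA : barrier A set0 [set A] by rewrite cards1 cards0.
  apply/barrierP; rewrite sub0set; split=> // [|C].
    by apply/trivIsetP=> C1 C2; rewrite !inE => /eqP-> /eqP->; rewrite eqxx.
  by rewrite inE => /eqP->; rewrite setD0; split=> //; apply/closed_inP.
have /barrierP[XA tCC CCP] := bar.
(* The rest is even. If it had a vertex [b], moving [b] to [X] and adding [B :\ b] to [CC] would
   give a tight barrier with a larger deleted set. *)
have B0 : A :\: X :\: cover CC = set0.
  set B := _ :\: _; apply/eqP; apply: contraT => /set0Pn[b Bb].
  have oB : ~~ odd #|B|.
    by rewrite barrier_rest_odd // cCC (negbTE evA) /= addbb.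
  have clB := barrier_rest_closed bar; rewrite -/B in clB.
  have [Ab Xb Cb] : [/\ b \in A, b \notin X & b \notin cover CC].
    by move: Bb; rewrite !inE => /and3P[].
  have dB C : C \in CC -> [disjoint B & C].
    move=> CCC; rewrite disjoint_subset; apply/subsetP=> x.
    by rewrite !inE => /andP[/bigcupP nc _]; apply/negP=> Cx; apply: nc; exists C.
  have oB1 : odd #|B :\ b| by move: oB; rewrite (cardsD1 b) Bb add1n /= negbK.
  have sB1 : B :\ b \subset B by apply: subD1set.
  have nB : B :\ b \notin CC.
    apply/negP=> /dB; rewrite -setI_eq0 (setIidPr sB1) => /eqP B10.
    by rewrite B10 cards0 in oB1.
  suff /maxX : barrier A (b |: X) (B :\ b |: CC).
    by rewrite !cardsU1 Xb nB cCC leqnn ltnn => /(_ isT).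
  apply/barrierP; rewrite subUset sub1set Ab XA; split=> //.
    apply/trivIsetP=> C1 C2; rewrite !inE.
    case/predU1P=> [->|C1C] /predU1P[->|C2C] //.
    - by rewrite eqxx.
    - by rewrite (disjointWl sB1) ?dB.
    - by rewrite disjoint_sym (disjointWl sB1) ?dB.
    by move/trivIsetP: tCC; apply.
  have sAX : A :\: (b |: X) \subset A :\: X by rewrite setDS // subsetUr.
  move=> C; rewrite in_setU1 => /predU1P[->|CCC]; split=> //.
  - by apply/subsetP=> x; rewrite !inE negb_or => /and4P[-> _ -> ->].
  - apply/closed_inP=> x y /setD1P[_ Bx] Ay exy; rewrite in_setD1.
    rewrite (closed_inP _ _ clB x) ?(subsetP sAX) // andbT.
    by move: Ay; rewrite !inE => /andP[/norP[]].
  - by have [] := CCP C CCC.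
  - have [_ sC _] := CCP C CCC; apply/subsetP=> x Cx.
    have := subsetP sC x Cx; rewrite !inE negb_or => /andP[-> ->]; rewrite !andbT.
    by apply: contra Cb => /eqP<-; apply/bigcupP; exists C.
  have [_ _ /closed_inP clC] := CCP C CCC.
  by apply/closed_inP=> x y Cx /(subsetP sAX); apply: clC.
(* By parity a violation [(Y, DD)] in [C :\ v] may be assumed to exceed by two. Together with [v],
   [X] and the other sets of [CC] it gives a tight barrier that deletes more than [X]. *)
have CmP C v : C \in CC -> v \in C -> perfectly_matched (C :\ v).
  move=> CCC Cv; have [oC sC clC] := CCP C CCC.
  have lC : #|C :\ v| < #|C| by rewrite [X in _ < X](cardsD1 v) Cv.
  have CA : C \subset A by apply: subset_trans sC (subsetDl _ _).
  apply: IHn.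
    by rewrite -ltnS (leq_trans _ ltA) // ltnS (leq_trans lC) // subset_leq_card.
  apply: tutte_condition_weaken; first by move: oC; rewrite (cardsD1 v) Cv add1n.
  move=> Y DD /barrierP[sY tDD DDP]; rewrite leqNgt; apply/negP=> ltY.
  have dX : [disjoint v |: Y & X].
    rewrite disjoint_subset; apply/subsetP=> x vYx; rewrite inE.
    have /(subsetP sC) : x \in C.
      by move: vYx; rewrite in_setU1 => /predU1P[->//|/(subsetP sY)/setD1P[]].
    by rewrite inE => /andP[].
  have vY : v \notin Y by apply/negP=> /(subsetP sY); rewrite !inE eqxx.
  have sD D : D \in DD -> D \subset C.
    by case/DDP=> _ sD _; rewrite (subset_trans sD) // (subset_trans (subsetDl _ _)) // subD1set.
  have dDC D C' : D \in DD -> C' \in CC :\ C -> [disjoint D & C'].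
    move=> /sD DC /setD1P[nC' C'CC]; apply: disjointWl DC _.
    by move/trivIsetP: tCC; apply; rewrite // eq_sym.
  have dDD : [disjoint DD & CC :\ C].
    rewrite disjoint_subset; apply/subsetP=> D DDD; rewrite inE; apply/negP=> /(dDC _ _ DDD).
    have [oD _ _] := DDP D DDD.
    by rewrite -setI_eq0 setIid => /eqP D0; rewrite D0 cards0 in oD.
  have cX : #|(v |: Y) :|: X| = #|Y|.+1 + #|X|.
    by rewrite cardsU (disjoint_setI0 dX) cards0 subn0 cardsU1 vY.
  have cCC' : #|DD :|: CC :\ C| + 1 = #|DD| + #|CC|.
    by rewrite cardsU (disjoint_setI0 dDD) cards0 subn0 (cardsD1 C CC) CCC addn1 add1n addnS.
  have bar' : barrier A ((v |: Y) :|: X) (DD :|: CC :\ C).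
    have YC : v |: Y \subset C.
      by rewrite subUset sub1set Cv (subset_trans sY) // subD1set.
    have sAX : A :\: (v |: Y :|: X) \subset A :\: X by rewrite setDS // subsetUr.
    apply/barrierP; rewrite subUset XA (subset_trans YC) //; split=> //.
      apply/trivIsetP=> D1 D2; rewrite !in_setU.
      case/orP=> D1D /orP[]D2D nD.
      - by move/trivIsetP: tDD; apply.
      - exact: dDC.
      - by rewrite disjoint_sym dDC.
      by move: D1D D2D => /setD1P[_ D1D] /setD1P[_ D2D]; move/trivIsetP: tCC; apply.
    move=> D; rewrite in_setU => /orP[DDD|/setD1P[nDC DCC]].
      have [oD sDC /closed_inP clD] := DDP D DDD; split=> //.
        apply/subsetP=> x Dx; have := subsetP (subset_trans (sD _ DDD) sC) _ Dx.
        have := subsetP sDC x Dx; rewrite !inE => /and3P[/negbTE-> /negbTE-> _].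
        by case/andP=> /negbTE-> ->.
      apply/closed_inP=> x y Dx Ay exy; apply: (clD x y) => //.
      have Cy : y \in C.
        by apply: (closed_inP _ _ clC x); rewrite ?(subsetP sAX) ?(subsetP (sD _ DDD)).
      by move: Ay; rewrite !inE Cy => /andP[/norP[/norP[-> ->]]].
    have [oD sDX /closed_inP clD] := CCP D DCC; split=> //.
      apply/subsetP=> x Dx; have := subsetP sDX x Dx; rewrite !in_setD.
      case/andP=> nX ->; rewrite andbT in_setU (negbTE nX) orbF.
      apply/negP=> /(subsetP YC) Cx; have /trivIsetP/(_ D C DCC CCC nDC) := tCC.
      by move/disjointFr/(_ Dx); rewrite Cx.
    by apply/closed_inP=> x y Dx /(subsetP sAX); apply: clD.
  move: (maxX _ _ bar') (tA _ _ bar'); rewrite cX; move: cCC' ltY; rewrite cCC.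
  by move: #|DD| #|Y| #|X| #|_ :|: _|; clear; lia.
(* Hall's condition for [CC'] is the Tutte condition for the barrier that deletes only the
   neighbours of [CC'] in [X]. *)
have [|f [injf fP]] := @hall _ _ a (fun C x => (x \in X) && [exists v in C, e v x]) CC.
  move=> CC' sCC'; apply: tA; apply/barrierP; split.
  - by apply/subsetP=> x /joint_nbhdP[C _ /andP[/(subsetP XA)]].
  - by apply: trivIsetS tCC.
  move=> C CCC'; have CCC := subsetP sCC' C CCC'; have [oC sC /closed_inP clC] := CCP C CCC.
  split=> //.
    apply/subsetP=> x Cx; have := subsetP sC x Cx; rewrite !in_setD => /andP[nX ->].
    by rewrite andbT; apply: contra nX => /joint_nbhdP[C' _ /andP[]].
  apply/closed_inP=> x y Cx; rewrite inE => /andP[nJ Ay] exy.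
  apply: clC (Cx) _ (exy); rewrite inE Ay andbT; apply: contra nJ => Xy.
  by apply/joint_nbhdP; exists C; rewrite // Xy; apply/exists_inP; exists x.
have imf : f @: CC = X.
  apply/eqP; rewrite eqEcard card_in_imset // cCC leqnn andbT.
  by apply/subsetP=> x /imsetP[C /fP/andP[Xx _] ->].
have -> : A = \bigcup_(C in CC) (f C |: C).
  apply/setP=> x; apply/idP/bigcupP=> [Ax|[C CCC]]; last first.
    rewrite in_setU1 => /predU1P[->|Cx]; first by have /andP[/(subsetP XA)] := fP C CCC.
    by have [_ /subsetP/(_ x Cx)] := CCP C CCC; rewrite inE => /andP[].
  have [Xx|nXx] := boolP (x \in X).
    by move: Xx; rewrite -imf => /imsetP[C CCC ->]; exists C; rewrite // setU11.
  have : x \notin A :\: X :\: cover CC by rewrite B0 inE.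
  rewrite !inE Ax nXx !andbT negbK => /bigcupP[C CCC Cx].
  by exists C; rewrite // setU1r.
have fX C : C \in CC -> f C \in X by case/fP/andP.
have fC C C' : C \in CC -> C' \in CC -> f C \notin C'.
  move=> CCC /CCP[_ /subsetP sC' _]; apply/negP=> /sC'.
  by rewrite inE fX.
apply: perfectly_matched_bigcup => [C C' CCC CCC' nCC'|C CCC].
  rewrite disjoint_subset; apply/subsetP=> x; rewrite !inE => /predU1P[->|Cx].
    by rewrite negb_or fC // andbT (inj_in_eq injf).
  rewrite negb_or; apply/andP; split.
    by apply: contraTneq Cx => ->; apply: fC.
  by have /trivIsetP/(_ C C' CCC CCC' nCC')/disjointFr-> := tCC.
have /andP[_ /exists_inP[v Cv evf]] := fP C CCC.
have -> : f C |: C = [set v; f C] :|: C :\ v.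
  by apply/setP=> x; rewrite !inE; case: (eqVneq x v) => [->|]; rewrite ?Cv ?orbT.
apply: perfectly_matchedU (CmP _ _ CCC Cv); last exact: perfectly_matched2.
rewrite disjoint_subset; apply/subsetP=> x; rewrite !inE => /orP[]/eqP->.
  by rewrite eqxx.
by rewrite negb_and (fC C C) ?orbT.
Qed.
End Tutte.

(** * Perfect matchings from weights with heavy odd cuts *)

Section WeightedCuts.
Variables (V : finType) (w : V -> V -> nat) (D : nat) (U : {set V}).
Hypotheses (wC : forall x y, w x y = w y x) (w0 : forall x, w x x = 0).
Hypotheses (D_gt0 : 0 < D) (wD : forall x, \sum_y w x y <= D).
Hypotheses (evU : ~~ odd #|U|) (outU : \sum_(x in ~: U) \sum_(y in U) w x y <= D).

Definition cut (C : {set V}) := \sum_(x in C) \sum_(y in ~: C) w x y.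

Hypothesis cutD : forall C : {set V}, C \subset U -> odd #|C| -> D <= cut C.

(** Each odd set of a barrier sends out weight at least [D], all of it to [X] or out of [U]. These
    absorb at most [D] per vertex of [X], plus [D], so [#|CC| <= #|X|.+1], and parity removes the
    excess. This slack is what permits one vertex of full weight to be left out of [U]. *)
Theorem perfectly_matched_of_cuts : perfectly_matched (fun x y => 0 < w x y) U.
Proof.
have gC : symmetric (fun x y => 0 < w x y) by move=> x y; rewrite wC.
apply: tutte => // [x|]; first by rewrite w0.
apply: tutte_condition_weaken => // X CC /barrierP[XU tCC CCP].
rewrite -(leq_pmul2l D_gt0) mulnS.
have le1 : D * #|CC| <= \sum_(C in CC) \sum_(x in C) \sum_(y in X :|: ~: U) w x y.
  rewrite mulnC -sum_nat_const; apply: leq_sum => C CCC.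
  have [oC sC /closed_inP clC] := CCP C CCC.
  have CU : C \subset U := subset_trans sC (subsetDl _ _).
  apply: leq_trans (cutD CU oC) _; apply: leq_sum => x Cx.
  rewrite big_mkcond [X in _ <= X]big_mkcond; apply: leq_sum => y _.
  rewrite !inE; case: ifP => // nCy; case: ifP => // /norP[nX]; rewrite negbK => Uy.
  rewrite leqNgt; apply/negP=> wxy; move/negP: nCy; apply.
  by apply: clC wxy; rewrite // inE nX.
apply: leq_trans le1 _; rewrite -big_trivIset //=.
have sC : cover CC \subset U.
  by apply/bigcupsP=> C /CCP[_ sC _]; apply: subset_trans sC (subsetDl _ _).
apply: leq_trans (_ : \sum_(x in U) \sum_(y in X :|: ~: U) w x y <= _).
  rewrite big_mkcond [X in _ <= X]big_mkcond; apply: leq_sum => x _.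
  by case: ifP => // /(subsetP sC)->.
rewrite exchange_big /= (eq_bigr (fun y => \sum_(x in U) w y x)); last first.
  by move=> y _; apply: eq_bigr => x _.
rewrite addnC (big_setID X) /= (setIidPr (subsetUl _ _)); apply: leq_add.
  rewrite mulnC -sum_nat_const; apply: leq_sum => x _; apply: leq_trans (wD x).
  by rewrite big_mkcond; apply: leq_sum => y _; case: ifP.
apply: leq_trans outU; rewrite big_mkcond [X in _ <= X]big_mkcond.
by apply: leq_sum => y _; rewrite !inE; case: (y \in X).
Qed.
End WeightedCuts.

(** * Degree-two subgraphs with free boundary edges *)

Section Boundary.
Variables (T : finType) (e : rel T).

Definition boundary (A : {set T}) : {set T * T} :=
  [set p | [&& p.1 \in A, p.2 \notin A & e p.1 p.2]].

Lemma boundaryP (A : {set T}) v u :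
  reflect [/\ v \in A, u \notin A & e v u] ((v, u) \in boundary A).
Proof. by rewrite inE /=; apply: and3P. Qed.
End Boundary.

Definition swap (T : Type) (p : T * T) := (p.2, p.1).

Lemma swapK (T : Type) : involutive (@swap T).
Proof. by case. Qed.

Lemma even_swap_closed (T : finType) (S : {set T * T}) :
  (forall v, (v, v) \notin S) -> (forall p, p \in S -> swap p \in S) -> ~~ odd #|S|.
Proof.
move=> irrS symS; pose up := [set p : T * T | enum_rank p.1 < enum_rank p.2].
rewrite -(cardsID up S); have -> : S :\: up = (@swap T) @: (S :&: up).
  apply/setP=> -[v u]; apply/idP/imsetP => [|[[v' u']]].
    rewrite !inE /= -leqNgt => /andP[le Svu]; exists (u, v) => //.
    have Suv := symS _ Svu; rewrite inE Suv inE /= ltn_neqAle le andbT.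
    by apply: contra (irrS v) => /eqP/ord_inj/enum_rank_inj E; rewrite -[X in (_, X)]E.
  rewrite !inE /= => /andP[S' lt] [-> ->].
  by have /= -> := symS _ S'; rewrite -leqNgt ltnW.
by rewrite card_imset ?addnn ?odd_double //; apply: can_inj (@swapK T).
Qed.

Lemma pair_inj (T1 T2 : Type) (x : T1) : injective (@pair T1 T2 x).
Proof. by move=> y z []. Qed.
Arguments pair_inj {T1 T2} x [x1 x2].

(** In a cut of the gadget, [m] counts split inner edges, [D] half-edges separated from both cores
    of their vertex, and [j] split pairs of the outer clique. A split clique ([K <= j]) already
    costs [(d - 2) * K]; less than [2 * K] remains, and any other term costs at least that since
    [4 <= d]. *)
Lemma gadget_arith1 d K m D j : 4 <= d -> 0 < K -> K <= j ->
  (d - 2) * K * m + (d - 2) * j + K * (D * 2) < d * K -> m = 0 /\ D = 0.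
Proof.
move=> d4; rewrite -(subnK (ltnW (ltnW d4))); have : 1 < d - 2 by lia.
move: (d - 2) => c c2; rewrite addnK => K0 Kj lt.
have cj : c * K <= c * j by rewrite leq_mul2l Kj orbT.
have c2K : 2 * K <= c * K by rewrite leq_mul2r c2 orbT.
have {}lt : c * K * m + K * (D * 2) < 2 * K.
  by move: lt cj; rewrite mulnDl; clear; lia.
case: (posnP m) lt => [->|m0] lt; last first.
  have : c * K * 1 <= c * K * m by rewrite leq_mul2l m0 orbT.
  lia.
by case: (posnP D) lt => [->|D0] // lt; nia.
Qed.
(** A first split edge costs as much as the split clique above, so the same bound excludes a second
    one. *)
Lemma gadget_arith2 d K m D j : 4 <= d -> 0 < K -> 0 < m ->
  (d - 2) * K * m + j + K * (D * 2) < d * K -> m = 1 /\ D = 0.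
Proof.
move=> d4 K0 m0 lt.
have [E ->] : m.-1 = 0 /\ D = 0.
  apply: (@gadget_arith1 d K _ _ K) => //; apply: leq_ltn_trans lt.
  by rewrite leq_add2r -{2}(prednK m0) mulnS; lia.
by rewrite -(prednK m0) E.
Qed.

(** * The gadget for 2-factors with optional boundary edges *)

Section Gadget.
Variables (T : finType) (e : rel T) (B : {set T}) (d : nat).
Hypotheses (eC : symmetric e) (e0 : irreflexive e) (d_ge4 : 4 <= d).
Hypothesis degB : forall v, v \in B -> deg e v = d.

Let inner : {set T * T} := [set p | [&& p.1 \in B, p.2 \in B & e p.1 p.2]].
Let outer := boundary e B.
Let half : {set T * T} := [set p | (p.1 \in B) && e p.1 p.2].
Let k := #|outer|.
(** An outer half-edge divides the weight [(d - 2) * K] among the [k.-1] others; this scale makes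
    each share the integer [d - 2]. The maximum with 1 keeps [K] positive for [k <= 1]. *)
Let K := maxn 1 k.-1.

Let K_gt0 : 0 < K. Proof. by rewrite leq_maxl. Qed.

Lemma halfE : half = inner :|: outer.
Proof.
by apply/setP=> -[v u]; rewrite !inE /=; case: (v \in B); case: (u \in B); rewrite ?orbF.
Qed.

Lemma inner_outer : [disjoint inner & outer].
Proof.
rewrite disjoint_subset; apply/subsetP=> -[v u].
by rewrite !inE /= => /and3P[-> -> _].
Qed.

Lemma inner_swap p : p \in inner -> swap p \in inner.
Proof. by rewrite !inE /= eC => /and3P[-> ->]. Qed.

Lemma card_half_at v : v \in B -> #|[set p in half | p.1 == v]| = d.
Proof.
move=> Bv; rewrite -(degB Bv) /deg -(card_imset (mem (nbhd e v)) (pair_inj v)).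
apply: eq_card => -[v' u]; rewrite !inE /=; apply/idP/imsetP => [|[u']].
  by case/andP=> /andP[_ evu] /eqP E; exists u; rewrite -E // inE.
by rewrite inE => evu [-> ->]; rewrite Bv eqxx evu.
Qed.

Lemma card_inner_even : ~~ odd #|inner|.
Proof.
apply: even_swap_closed => [v|p /inner_swap//].
by rewrite inE /= e0 !andbF.
Qed.

Lemma card_half : #|half| = #|B| * d.
Proof.
rewrite -sum_nat_const -sum1_card (partition_big fst (mem B)) /=; last first.
  by move=> p; rewrite inE => /andP[].
apply: eq_bigr => v Bv; rewrite -(card_half_at Bv) -sum1_card.
by apply: eq_bigl => p; rewrite [in RHS]inE.
Qed.

(* Tutte's gadget for 2-factors: one vertex per half-edge at B, two core vertices
   per vertex of B. A half-edge matched to a core is selected. The half-edges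
   leaving B form a clique, so that they may be selected or not. *)
Notation vertex := ((T * T) + (T * bool))%type.

(** The fractional matching that selects every edge with weight 2/d, scaled by [d * K]: a half-edge
    has weight [K] to each of its two cores, and the remaining [(d - 2) * K] goes to its reverse or,
    if it is outer, is spread over the other outer half-edges, if any. *)
Let half_weight (p q : T * T) :=
  if (p \in inner) && (q == swap p) then (d - 2) * K
  else if [&& p \in outer, q \in outer & p != q] then d - 2 else 0.

Let weight (x y : vertex) : nat :=
  match x, y with
  | inl p, inl q => half_weight p q
  | inl p, inr c | inr c, inl p => if (p \in half) && (c.1 == p.1) then K else 0
  | inr _, inr _ => 0
  end.

Lemma weightC x y : weight x y = weight y x.
Proof.
case: x y => [p|c] [q|c'] //=; rewrite /half_weight.
have -> : (p \in inner) && (q == swap p) = (q \in inner) && (p == swap q).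
  apply/andP/andP=> -[pI /eqP E]; rewrite E ?swapK ?eqxx inner_swap //.
by rewrite [p == q]eq_sym (andbCA (p \in outer)).
Qed.

Lemma weightxx x : weight x x = 0.
Proof.
case: x => [[v u]|c] //=; rewrite /half_weight eqxx !andbF.
case: ifP => // /andP[]; rewrite inE /= => /and3P[_ _ evu] /eqP[E _].
by rewrite E e0 in evu.
Qed.

Lemma sum_vertex (F : vertex -> nat) :
  \sum_x F x = \sum_p F (inl p) + \sum_c F (inr c).
Proof. exact: big_sumType. Qed.

Lemma weight_degree x : \sum_y weight x y <= d * K.
Proof.
rewrite sum_vertex; case: x => [p|[v b]] /=; last first.
  rewrite [X in _ + X]big1 // addn0.
  have [Bv|nBv] := boolP (v \in B); last first.
    rewrite big1 // => p _; case: ifP => // /andP[]; rewrite inE => /andP[Bp _] /eqP E.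
    by rewrite E Bp in nBv.
  rewrite -big_mkcond sum_nat_const leq_mul2r -(card_half_at Bv) subset_leq_card ?orbT //.
  by apply/subsetP=> p /andP[hp /eqP E]; rewrite inE hp E /=.
have [ph|nph] := boolP (p \in half); last first.
  rewrite [X in X + _]big1 => [|q _]; first by rewrite big1 // => c _; rewrite (negbTE nph).
  by rewrite /half_weight; move: nph; rewrite halfE inE => /norP[/negbTE-> /negbTE->].
have -> : d * K = (d - 2) * K + 2 * K by rewrite -mulnDl subnK // ltnW // ltnW.
apply: leq_add; last first.
  rewrite -big_mkcond sum_nat_const leq_mul2r; apply/orP; right.
  rewrite -card_bool -(card_imset predT (pair_inj p.1)) subset_leq_card //.
  by apply/subsetP=> -[v b]; rewrite unfold_in => /eqP/= ->; apply: imset_f.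
have [pI|npI] := boolP (p \in inner).
  rewrite (bigD1 (swap p)) //= big1 ?addn0 => [|q nq].
    by rewrite /half_weight pI eqxx.
  by rewrite /half_weight pI (negbTE nq) (disjointFr inner_outer pI).
have pO : p \in outer by move: ph; rewrite halfE inE (negbTE npI).
have -> : \sum_q half_weight p q = \sum_(q in outer :\ p) (d - 2).
  rewrite [RHS]big_mkcond; apply: eq_bigr => q _.
  by rewrite /half_weight (negbTE npI) pO in_setD1 [q == p]eq_sym; case: (p == q); case: (q \in outer).
rewrite sum_nat_const mulnC leq_mul2l; apply/orP; right.
have -> : #|outer :\ p| = k.-1 by rewrite /k (cardsD1 p outer) pO.
exact: leq_maxr.
Qed.

Section Cut.
Variables (C : {set vertex}).
Let P := [set p | inl p \in C].
Let core v b : bool := inr (v, b) \in C.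
Let mixed p := ((p \in P) != core p.1 true) + ((p \in P) != core p.1 false).
Let M := [set p in inner :&: P | swap p \notin P].

Lemma cutE : cut weight C =
  \sum_(p in P) \sum_(q in ~: P) half_weight p q + K * \sum_(p in half) mixed p.
Proof.
have -> : cut weight C = \sum_x \sum_y (if (x \in C) && (y \notin C) then weight x y else 0).
  rewrite /cut big_mkcond; apply: eq_bigr => x _.
  case: ifP => _ /=; last by rewrite big1.
  by rewrite big_mkcond; apply: eq_bigr => y _; rewrite inE.
rewrite sum_vertex (eq_bigr _ (fun p _ => sum_vertex _)) big_split /= -addnA; congr (_ + _).
  rewrite [RHS]big_mkcond; apply: eq_bigr => p _; rewrite [p \in P]inE.
  case: ifP => _ /=; last by rewrite big1.
  by rewrite [RHS]big_mkcond; apply: eq_bigr => q _; rewrite !inE.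
rewrite [X in _ + X](eq_bigr _ (fun p _ => sum_vertex _)) big_split /=.
rewrite [X in _ + (_ + X)]big1 ?addn0; last by move=> c _; rewrite big1 // => c' _; case: ifP.
rewrite [X in _ + X]exchange_big -big_split /= big_distrr /= [RHS]big_mkcond.
apply: eq_bigr => p _; rewrite -big_split /=.
case ph : (p \in half); last by rewrite big1 // => c _ /=; rewrite !if_same.
rewrite (eq_bigr (fun c : T * bool => if c.1 == p.1 then
   K * ((p \in P) != core c.1 c.2) else 0)); last first.
  move=> [v b] _ /=; rewrite inE /core; case: (v == p.1); rewrite ?if_same //.
  by case: (inl p \in C); case: (inr (v, b) \in C); rewrite ?muln0 ?muln1 ?addn0.
rewrite -big_mkcond /= (eq_bigl (fun c => (c.1 == p.1) && true)); last by move=> c; rewrite andbT.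
rewrite -(pair_big (fun v => v == p.1) xpredT (fun v b => K * ((p \in P) != core v b))) /=.
by rewrite big_pred1_eq /= big_bool mulnDr.
Qed.

Lemma cut_half_weight :
  (d - 2) * K * #|M| + (d - 2) * (#|P :&: outer| * #|outer :\: P|) <=
  \sum_(p in P) \sum_(q in ~: P) half_weight p q.
Proof.
have -> : (d - 2) * K * #|M| = \sum_(p in P) (if p \in M then (d - 2) * K else 0).
  rewrite -big_mkcondr mulnC -sum_nat_const; apply: eq_bigl => p.
  by rewrite !inE; case: (inl p \in C); rewrite ?andbF.
have -> : (d - 2) * (#|P :&: outer| * #|outer :\: P|) =
    \sum_(p in P) (if p \in outer then (d - 2) * #|outer :\: P| else 0).
  rewrite -big_mkcondr mulnCA -sum_nat_const; apply: eq_bigl => p.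
  by rewrite !inE.
rewrite -big_split; apply: leq_sum => p Pp /=.
have [pO|npO] := boolP (p \in outer).
  have -> : p \in M = false.
    rewrite inE inE; case pI : (p \in inner) => //.
    by rewrite (disjointFr inner_outer pI) in pO.
  rewrite add0n mulnC -sum_nat_const big_mkcond [X in _ <= X]big_mkcond.
  apply: leq_sum => q _; rewrite in_setD in_setC; case nPq : (q \in P) => //=.
  case qO : (q \in outer) => //; rewrite /half_weight pO qO.
  have -> : p \in inner = false by apply/negP=> /(disjointFr inner_outer); rewrite pO.
  by rewrite /=; case: eqVneq => //= E; rewrite -E Pp in nPq.
rewrite addn0; case: ifP => //; rewrite in_set in_setI => /andP[/andP[pI _] nP].
rewrite (bigD1 (swap p)); last by rewrite in_setC.
by rewrite {1}/half_weight pI eqxx leq_addr.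
Qed.
End Cut.

(** Each of the [d] half-edges at [v] is separated from exactly one of the two cores, at cost
    [K]. *)
Lemma core_cut (C : {set vertex}) v : v \in B ->
  (inr (v, true) \in C) != (inr (v, false) \in C) -> d * K <= cut weight C.
Proof.
move=> Bv nC; rewrite cutE; apply: leq_trans (leq_addl _ _).
rewrite mulnC leq_mul2l; apply/orP; right.
rewrite -[leqLHS](card_half_at Bv) -sum1_card big_mkcond [leqRHS]big_mkcond.
apply: leq_sum => p _; rewrite inE; case: (p \in half) => //=; case: eqP => // ->.
by move: nC; case: (_ \in C); case: (_ \in C); case: (_ \in _).
Qed.

Section Factor.
(** [W] removes one outer half-edge when their number is odd, which makes the order of the gadget
    even. If [k] is 1, it removes the only way out of [B]. *)
Variable W : {set T * T}.
Hypotheses (sW : W \subset outer) (cW : #|W| = odd k).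
Hypothesis not_bridge : forall A : {set T}, A \proper B -> A != set0 -> #|boundary e A| != 1.
Hypothesis conn : 1 < k -> forall A : {set T}, A \proper B -> A != set0 ->
  exists v u, [/\ v \in A, u \in B :\: A & e v u].

Let U : {set vertex} :=
  [set x | match x with inl p => p \in half :\: W | inr c => c.1 \in B end].

Lemma cores_eq (C : {set vertex}) v : C \subset U -> cut weight C < d * K ->
  (inr (v, true) \in C) = (inr (v, false) \in C).
Proof.
move=> /subsetP CU small; have [Bv|nBv] := boolP (v \in B).
  by apply/eqP; apply: contraLR small => nC; rewrite -leqNgt (core_cut Bv).
have nC b : inr (v, b) \in C = false.
  by apply/negP=> /CU; rewrite inE /= (negbTE nBv).
by rewrite !nC.
Qed.

Lemma odd_gadget_set (C : {set vertex}) :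
  (forall v, (inr (v, true) \in C) = (inr (v, false) \in C)) ->
  odd #|C| = odd #|[set p | inl p \in C]|.
Proof.
move=> coresE; rewrite -sum1_card big_mkcond sum_vertex oddD.
have -> : \sum_p (if inl p \in C then 1 else 0) = #|[set p | inl p \in C]|.
  by rewrite -big_mkcond sum1dep_card.
have -> : \sum_c (if inr c \in C then 1 else 0) = \sum_v \sum_b (inr (v, b) \in C : nat).
  by rewrite pair_big; apply: eq_bigr => -[v b] _ /=; case: ifP.
rewrite (eq_bigr (fun v => (inr (v, true) \in C) * 2)); last first.
  by move=> v _; rewrite big_bool /= -coresE muln2 addnn.
by rewrite -big_distrl /= muln2 odd_double addbF.
Qed.

(* In a cut of weight below d * K no vertex has exactly one core in C. Let A be the
   set of vertices with both cores in C, Dev the half-edges on which C and A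
   disagree, and M the edges split by C. Smallness leaves three cases: nothing is
   split and |C| is even, or one edge is split and it is the only one leaving A or
   B - A, or only the clique on the outer half-edges is split and A is a union of
   components of B. *)
Lemma cut_big (C : {set vertex}) : C \subset U -> odd #|C| -> d * K <= cut weight C.
Proof.
move=> CU oC; rewrite leqNgt; apply/negP=> small.
have coresE v := cores_eq v CU small.
rewrite odd_gadget_set // in oC; move: small; rewrite cutE.
have := cut_half_weight C; set EE := \sum_(p in _) _.
set P := [set p | inl p \in C] in oC EE *.
set M := [set p in inner :&: P | swap p \notin P].
pose A := [set v in B | inr (v, true) \in C].
pose Dev := [set p in half | (p \in P) != (p.1 \in A)].
rewrite (eq_bigr (fun p => if (p \in P) != (p.1 \in A) then 2 else 0)); last first.
  move=> p; rewrite -coresE [p.1 \in A]inE => hp.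
  have -> : p.1 \in B by move: hp; rewrite inE => /andP[].
  by case: (_ != _).
rewrite -big_mkcondr /= (eq_bigl (fun p => p \in Dev)); last by move=> p; rewrite [p \in Dev]inE.
rewrite sum_nat_const => leEE small.
have {leEE small} lt : (d - 2) * K * #|M| + (d - 2) * (#|P :&: outer| * #|outer :\: P|)
    + K * (#|Dev| * 2) < d * K.
  by apply: leq_ltn_trans small; rewrite leq_add2r.
have kE : k = #|P :&: outer| + #|outer :\: P| by rewrite setIC cardsID.
have Ph : P \subset half.
  by apply/subsetP=> p; rewrite inE => /(subsetP CU); rewrite !inE => /andP[].
have PW : [disjoint P & W].
  rewrite disjoint_subset; apply/subsetP=> p; rewrite inE => /(subsetP CU).
  by rewrite !inE => /andP[].
have DevE : #|Dev| = 0 -> forall p, p \in half -> (p \in P) = (p.1 \in A).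
  move/eqP; rewrite cards_eq0 => /eqP D0 p hp; apply/eqP.
  have : p \notin Dev by rewrite D0 inE.
  by rewrite inE hp negbK.
have ME : #|M| = 0 -> forall p, p \in inner -> p \in P -> swap p \in P.
  move/eqP; rewrite cards_eq0 => /eqP M0 p ip Pp.
  have : p \notin M by rewrite M0 inE.
  by rewrite inE inE ip Pp negbK.
have inner_half : inner \subset half by rewrite halfE subsetUl.
have outer_half : outer \subset half by rewrite halfE subsetUr.
have AB : A \subset B by apply/subsetP=> v; rewrite inE => /andP[].
have [[[p1 p1P] [p2 p2P]]|] : ((exists p, p \in P :&: outer) /\ (exists p, p \in outer :\: P))
    \/ (P :&: outer = set0 \/ outer :\: P = set0).
  have [->|/set0Pn[p Pp]] := eqVneq (P :&: outer) set0; first by right; left.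
  have [->|/set0Pn[q Pq]] := eqVneq (outer :\: P) set0; first by right; right.
  by left; split; [exists p | exists q].
  have j1 : 0 < #|P :&: outer| by apply/card_gt0P; exists p1.
  have j2 : 0 < #|outer :\: P| by apply/card_gt0P; exists p2.
  have k1 : 1 < k by rewrite kE; move: j1 j2; clear; lia.
  (* A product of two positive integers is at least their sum minus one, which is [k.-1] here. *)
  have leK : K <= #|P :&: outer| * #|outer :\: P|.
    by rewrite /K kE; move: j1 j2; clear; nia.
  have [m0 D0] : #|M| = 0 /\ #|Dev| = 0.
    exact: gadget_arith1 d_ge4 K_gt0 leK lt.
  move/setIP: p1P => [p1P p1O]; move/setDP: p2P => [p2O p2P].
  have Ap1 : p1.1 \in A by rewrite -(DevE D0) // (subsetP outer_half).
  have Ap2 : p2.1 \notin A by rewrite -(DevE D0) // (subsetP outer_half).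
  have Bp2 : p2.1 \in B by move: p2O; rewrite inE => /and3P[].
  have [||v [u [Av /setDP[Bu Au] evu]]] := conn k1 (A := A).
  - by rewrite properE AB; apply/subsetPn; exists p2.1.
  - by apply/set0Pn; exists p1.1.
  have vuI : (v, u) \in inner by rewrite inE /= (subsetP AB) // Bu.
  have vuP : (v, u) \in P by rewrite (DevE D0) ?(subsetP inner_half).
  have := ME m0 _ vuI vuP; rewrite (DevE D0) ?(negbTE Au) //.
  by rewrite (subsetP inner_half) // inner_swap.
(* With no inner edge split, the inner part of [P] is closed under reversal, hence even. The outer
   part is empty or everything; the latter forces [W] to be empty, and so [k] to be even. *)
move=> triv; have [m0|m_gt0] := posnP #|M|.
  have PIev : ~~ odd #|P :&: inner|.
    apply: even_swap_closed => [v|p /setIP[Pp ip]].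
      by rewrite !inE /= e0 !andbF.
    by rewrite inE (ME m0) // inner_swap.
  have PE : #|P| = #|P :&: inner| + #|P :&: outer|.
    rewrite -(cardsID inner P); congr (_ + _); apply: eq_card => p.
    rewrite in_setD in_setI andbC; case Pp : (p \in P) => //=.
    have := subsetP Ph p Pp; rewrite halfE in_setU.
    by case: (boolP (p \in inner)) => [/(disjointFr inner_outer)|].
  move: oC; rewrite PE oddD (negbTE PIev) /=.
  case: triv => [->|Oout]; first by rewrite cards0.
  have outP : outer \subset P by rewrite -setD_eq0 Oout.
  rewrite (setIidPr outP) -/k => ok; move: cW; rewrite ok => W1.
  have /card_gt0P[p Wp] : 0 < #|W| by rewrite W1.
  by have := disjointFl PW Wp; rewrite (subsetP outP) ?(subsetP sW).
have [m1 D0] := gadget_arith2 d_ge4 K_gt0 m_gt0 lt.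
have /cards1P[[v u] Mvu] : #|M| == 1 by rewrite m1.
have : (v, u) \in M by rewrite Mvu inE.
rewrite inE inE => /andP[/andP[vuI vuP] uvP].
have Av : v \in A by rewrite -(DevE D0 (v, u)) ?(subsetP inner_half).
have Bu : u \in B by move: vuI; rewrite inE => /and3P[].
have Au : u \notin A.
  by rewrite -(DevE D0 (u, v)) // (subsetP inner_half) // (inner_swap vuI).
have A0 : A != set0 by apply/set0Pn; exists v.
have pA : A \proper B by rewrite properE AB; apply/subsetPn; exists u.
case: triv => [Oin|Oout].
  have := not_bridge pA A0; suff -> : boundary e A = M by rewrite m1.
  apply/setP=> -[x y]; apply/boundaryP/idP => [[Ax Ay exy]|]; last first.
    rewrite [_ \in M]inE in_setI => /andP[/andP[xyI xyP] yxP].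
    move: xyP yxP; rewrite !(DevE D0) ?(subsetP inner_half) ?(inner_swap xyI) //= => -> ->.
    by move: xyI; rewrite inE => /and3P[]; split.
  rewrite [_ \in M]inE in_setI.
    have xyh : (x, y) \in half by rewrite inE /= exy (subsetP AB).
    have xyP : (x, y) \in P by rewrite (DevE D0).
    move: (xyh); rewrite halfE inE => /orP[xyI|xyO]; last first.
      have : (x, y) \in P :&: outer by rewrite inE xyP xyO.
      by rewrite Oin inE.
    by rewrite xyI xyP (DevE D0) // (subsetP inner_half) // (inner_swap xyI).
have outP : outer \subset P by rewrite -setD_eq0 Oout.
have nA0 : B :\: A != set0 by apply/set0Pn; exists u; rewrite inE Au.
have pBA : B :\: A \proper B.
  by rewrite properE subsetDl; apply/subsetPn; exists v; rewrite ?(subsetP AB) // inE Av.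
have := not_bridge pBA nA0.
suff -> : boundary e (B :\: A) = (@swap T) @: M.
  by rewrite card_imset ?m1 //; apply: can_inj (@swapK T).
apply/setP=> -[x y]; apply/boundaryP/imsetP => [[/setDP[Bx Ax] nBAy exy]|[[y' x'] yxM [-> ->]]].
  have xyh : (x, y) \in half by rewrite inE /= exy Bx.
  have xyP : (x, y) \notin P by rewrite (DevE D0).
  move: (xyh); rewrite halfE inE => /orP[xyI|/(subsetP outP)]; last by rewrite (negbTE xyP).
  exists (y, x) => //; have yxI := inner_swap xyI.
  rewrite inE inE yxI xyP (DevE D0) ?(subsetP inner_half) // andbT /=.
  have /and3P[_ By _] : [&& x \in B, y \in B & e x y] by move: xyI; rewrite inE.
  by move: nBAy; rewrite inE By andbT negbK.
move: yxM; rewrite inE inE => /andP[/andP[yxI yxP] xyP].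
have xyI := inner_swap yxI.
move: yxP xyP; rewrite !(DevE D0) ?(subsetP inner_half) //= => Ay' Ax'.
have /and3P[Bx' By' ex'y'] : [&& x' \in B, y' \in B & e x' y'] by move: xyI; rewrite inE.
by split; rewrite // in_setD ?Ax' ?Bx' ?Ay'.
Qed.

(** The partners of the two cores of [v] are its two selected half-edges. An inner half-edge that no
    core takes can only be matched to its reverse, so an inner edge is selected at both ends or at
    neither. *)
Theorem two_factor : exists F : T -> T -> bool,
  [/\ forall v, v \in B -> #|[set u | F v u]| = 2,
      forall v u, F v u -> v \in B /\ e v u,
      {in B &, forall v u, F v u = F u v} &
      forall v u, F v u -> k = 1 -> u \in B].
Proof.
have WU : W \subset half by rewrite halfE (subset_trans sW) ?subsetUr.
have D_gt0 : 0 < d * K by rewrite muln_gt0 K_gt0 andbT (leq_trans _ d_ge4).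
have evU : ~~ odd #|U|.
  rewrite odd_gadget_set; last by move=> v; rewrite !inE.
  have -> : [set p | inl p \in U] = half :\: W by apply/setP=> p; rewrite !inE.
  rewrite cardsD (setIidPr WU) oddB ?subset_leq_card // cW halfE cardsU.
  rewrite (disjoint_setI0 inner_outer) cards0 subn0 oddD (negbTE card_inner_even).
  by rewrite oddb addbb.
have outU : \sum_(x in ~: U) \sum_(y in U) weight x y <= d * K.
  apply: leq_trans (_ : \sum_(p in W) d * K <= _); last first.
    by rewrite sum_nat_const cW -[leqRHS]mul1n leq_mul2r leq_b1 orbT.
  rewrite big_mkcond sum_vertex [X in _ + X]big1 ?addn0; last first.
    move=> c _; case: ifP => //; rewrite !inE => nBc; apply: big1 => -[p|c'] //= _.
    case: ifP => // /andP[]; rewrite inE => /andP[Bp _] /eqP E.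
    by rewrite E Bp in nBc.
  rewrite [leqRHS]big_mkcond; apply: leq_sum => p _; rewrite !inE negb_and negbK.
  case: (boolP (p \in W)) => [_|_] /=.
    apply: leq_trans (weight_degree (inl p)).
    by rewrite big_mkcond; apply: leq_sum => y _; case: ifP.
  case: ifP => // nh; rewrite big1 // => -[q|c] _ /=; last first.
    by have -> : p \in half = false by rewrite inE (negbTE nh).
  have /negbT : p \in half = false by rewrite inE (negbTE nh).
  by rewrite halfE inE /half_weight => /norP[/negbTE-> /negbTE->].
have [m mP] := perfectly_matched_of_cuts weightC weightxx D_gt0 weight_degree evU outU cut_big.
pose F v u := [exists b, (v \in B) && (m (inr (v, b)) == inl (v, u))].
have Um v b : v \in B -> inr (v, b) \in U by rewrite inE.
have mcore v b : v \in B -> exists u, [/\ m (inr (v, b)) = inl (v, u), e v u & (v, u) \notin W].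
  move=> Bv; have [] := mP _ (Um v b Bv).
  case: (m _) => [[v' u]|c] //=; rewrite !inE /=.
  case: ifP => // /andP[_ /eqP E]; rewrite -E => /and3P[nW _ evu] _ _.
  by exists u.
have FP v u : F v u -> [/\ v \in B, e v u & (v, u) \notin W].
  case/existsP=> b /andP[Bv]; have [u' [-> evu nW]] := mcore v b Bv.
  by move/eqP=> [<-].
exists F; split=> [v Bv|v u /FP[]//|v u Bv Bu|v u /FP[Bv evu nW] k1].
- have [u1 [E1 _ _]] := mcore v true Bv; have [u2 [E2 _ _]] := mcore v false Bv.
  have nu : u1 != u2.
    apply: contraTneq isT => E; move: E2; rewrite -E -E1 => /(congr1 m).
    by have [_ -> _] := mP _ (Um v true Bv); have [_ -> _] := mP _ (Um v false Bv).
  have := cards2 u1 u2; rewrite nu => <-; apply: eq_card => u; rewrite !inE.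
  apply/existsP/orP=> [[[]]|[]/eqP->]; rewrite ?Bv ?E1 ?E2 /=.
  + by move/eqP=> [->]; left.
  + by move/eqP=> [->]; right.
  + by exists true; rewrite E1 eqxx.
  by exists false; rewrite E2 eqxx.
- suff sub x y : x \in B -> y \in B -> F x y -> F y x.
    by apply/idP/idP; apply: sub.
  move=> Bx By /existsP[b]; rewrite Bx => /eqP mxb.
  have exy : e x y by have [y' [E]] := mcore x b Bx; move: E; rewrite mxb => -[<-].
  have yxI : (y, x) \in inner by rewrite inE /= Bx By eC.
  have yxU : inl (y, x) \in U.
    rewrite inE in_setD halfE inE yxI andbT; apply: contraL yxI => /(subsetP sW) yxO.
    by rewrite (disjointFl inner_outer).
  have [] := mP _ yxU; case E : (m (inl (y, x))) => [q|[z b']] /= mU mm.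
    rewrite /half_weight yxI (disjointFr inner_outer yxI) /=.
    case: eqP => // Eq; move: mm; rewrite Eq /swap /= -mxb.
    by have [_ -> _] := mP _ (Um x b Bx).
  case: ifP => // /andP[_ /eqP /= Ez] _; apply/existsP; exists b'.
  by move: mm; rewrite Ez => ->; rewrite By eqxx.
apply: contraR nW => nBu; have vuO : (v, u) \in outer by apply/boundaryP.
suff -> : W = outer by [].
by apply/eqP; rewrite eqEcard sW cW -/k k1.
Qed.
End Factor.
End Gadget.

(** * Factors with components of degree two or three *)

Section BoundaryCounts.
Variables (T : finType) (e : rel T) (d : nat).
Hypotheses (eC : symmetric e) (e0 : irreflexive e).
Implicit Types A B : {set T}.

Lemma boundary_submodular A B :
  #|boundary e (A :&: B)| + #|boundary e (A :|: B)| <= #|boundary e A| + #|boundary e B|.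
Proof.
rewrite -[leqLHS]cardsUI -[leqRHS]cardsUI; apply: leq_add; apply: subset_leq_card;
  apply/subsetP=> -[v u]; rewrite !inE /=;
  by case: (v \in A); case: (v \in B); case: (u \in A); case: (u \in B); case: (e v u).
Qed.

Lemma card_boundaryC A : #|boundary e (~: A)| = #|boundary e A|.
Proof.
rewrite -(card_imset _ (can_inj (@swapK T))); apply: eq_card => -[v u].
apply/imsetP/boundaryP => [[[x y] /boundaryP[Ax Ay exy] [-> ->]]|[Av Au evu]].
  by rewrite !inE negbK in Ax Ay; rewrite eC.
by exists (u, v) => //; apply/boundaryP; rewrite !inE negbK eC.
Qed.

Lemma boundary_posimodular A B :
  #|boundary e (A :\: B)| + #|boundary e (B :\: A)| <= #|boundary e A| + #|boundary e B|.
Proof.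
rewrite setDE -(card_boundaryC (B :\: A)) setDE setCI setCK setUC.
by rewrite -(card_boundaryC B) boundary_submodular.
Qed.

Lemma odd_boundary A : (forall v, v \in A -> deg e v = d) ->
  odd #|boundary e A| = odd (#|A| * d).
Proof.
move=> degA; rewrite -(card_half degA) (halfE e A) cardsU.
rewrite (disjoint_setI0 (inner_outer e A)) cards0 subn0 oddD.
by rewrite (negbTE (card_inner_even A eC e0)).
Qed.
End BoundaryCounts.

(** * Splitting a connected graph of odd degree along its one-edge cuts *)

Section Step.
Variables (T : finType) (e : rel T) (d : nat).
Hypotheses (eC : symmetric e) (e0 : irreflexive e) (d_ge5 : 5 <= d) (od : odd d).
(** The vertices outside [S] are isolated: the inductions pass to subgraphs on the same type instead
    of to smaller vertex types. *)
Let S := [set v | deg e v == d].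
Hypothesis deg_out : forall v, v \notin S -> deg e v = 0.
Hypothesis conn : forall A : {set T}, A \proper S -> A != set0 ->
  exists v u, [/\ v \in A, u \in S :\: A & e v u].

Let degS v : v \in S -> deg e v = d. Proof. by rewrite inE => /eqP. Qed.

Lemma edge_supp v u : e v u -> (v \in S) && (u \in S).
Proof.
suff sub x y : e x y -> x \in S by move=> evu; rewrite (sub v u) ?(sub u v) // eC.
move=> exy; apply: contraT => /deg_out/eqP; rewrite cards_eq0 => /eqP N0.
have : y \in nbhd e x by rewrite inE.
by rewrite N0 inE.
Qed.

Let bridge_set (L : {set T}) := (L \subset S) && (#|boundary e L| == 1).
Let leaves : {set {set T}} := [set L | minset bridge_set L].

Lemma leafP L : L \in leaves -> [/\ L \subset S, #|boundary e L| = 1, L != set0 &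
  forall A : {set T}, A \proper L -> #|boundary e A| != 1].
Proof.
rewrite inE => /minsetP[/andP[LS /eqP L1] minL]; split=> //.
  apply/eqP=> L0; move: L1; rewrite L0; have -> : boundary e set0 = set0.
    by apply/setP=> -[v u]; rewrite !inE.
  by rewrite cards0.
move=> A /properP[AL [x Lx nAx]]; apply: contra nAx => A1.
by rewrite (minL A) // /bridge_set A1 (subset_trans AL).
Qed.

Lemma odd_boundaryS (A : {set T}) : A \subset S -> odd #|boundary e A| = odd #|A|.
Proof.
move=> /subsetP AS; rewrite (odd_boundary (d := d) eC e0) ?oddM ?od ?andbT //.
by move=> v /AS/degS.
Qed.

(** As [d] is odd, a set and its boundary agree in parity. If [L1] meets [L2] without lying in it,
    one of [L1 :&: L2] and [L1 :\: L2] is odd, and submodularity or posimodularity bounds its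
    boundary by 2, so it is 1. This contradicts the minimality of [L1]. *)
Lemma trivIset_leaves : trivIset leaves.
Proof.
apply/trivIsetP=> L1 L2 /leafP[L1S b1 _ m1] /leafP[L2S b2 _ m2] nL.
rewrite -setI_eq0; apply: contraNT nL => /set0Pn[x /setIP[L1x L2x]].
have odd1 (A : {set T}) : A \subset S -> #|boundary e A| <= 2 -> odd #|A| -> #|boundary e A| = 1.
  by move=> AS; rewrite -odd_boundaryS //; case: #|_| => [|[|[|n]]].
have [I1|nI1] := boolP (L1 \subset L2).
  have [//|nL] := eqVneq L1 L2.
  have /m2 : L1 \proper L2 by rewrite properEneq nL.
  by rewrite b1.
have IP : L1 :&: L2 \proper L1.
  by rewrite properE subsetIl; apply: contra nI1 => /subset_trans-> //; apply: subsetIr.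
have DP : L1 :\: L2 \proper L1.
  rewrite properE subsetDl; apply/negP=> /subsetP/(_ x L1x).
  by rewrite inE L2x.
have oL1 : odd #|L1| by rewrite -odd_boundaryS // b1.
case oI : (odd #|L1 :&: L2|).
  case/negP: (m1 _ IP); apply/eqP; apply: odd1 => //.
    exact: subset_trans (subsetIl _ _) L1S.
  apply: leq_trans (_ : _ <= #|boundary e L1| + #|boundary e L2|) _; last by rewrite b1 b2.
  exact: leq_trans (leq_addr _ _) (boundary_submodular _ _ _).
case/negP: (m1 _ DP); apply/eqP; apply: odd1.
- exact: subset_trans (subsetDl _ _) L1S.
- apply: leq_trans (_ : _ <= #|boundary e L1| + #|boundary e L2|) _; last by rewrite b1 b2.
  exact: leq_trans (leq_addr _ _) (boundary_posimodular eC _ _).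
by move: oL1; rewrite -(cardsID L2) oddD oI.
Qed.

Let W := S :\: cover leaves.

(** A subset of [W] with a one-edge boundary would contain a minimal such set, a leaf, while [W]
    avoids all leaves. Inside a leaf, minimality itself excludes such subsets. *)
Lemma piece_two_factor B : B \in W |: leaves -> exists F : T -> T -> bool,
  [/\ forall v, v \in B -> #|[set u | F v u]| = 2,
      forall v u, F v u -> v \in B /\ e v u,
      {in B &, forall v u, F v u = F u v} &
      forall v u, F v u -> #|boundary e B| = 1 -> u \in B].
Proof.
move=> BW.
have [X sX cX] : exists2 X : {set T * T},
    X \subset boundary e B & #|X| = odd #|boundary e B|.
  case: (boolP (odd _)) => [ob|_]; last by exists set0; rewrite ?sub0set ?cards0.
  have /card_gt0P[p Bp] : 0 < #|boundary e B| by case: #|_| ob.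
  by exists [set p]; rewrite ?sub1set ?cards1.
have BS : B \subset S.
  by case/setU1P: BW => [->|/leafP[]//]; apply: subsetDl.
have degB v : v \in B -> deg e v = d by move/(subsetP BS)/degS.
apply: (two_factor eC e0 (ltnW d_ge5) degB sX cX) => [A pA nA|].
  case/setU1P: BW => [EB|/leafP[_ _ _]]; last exact.
  have AB := proper_sub pA; apply/negP=> bA.
  have [L minL LA] : {L | minset bridge_set L & L \subset A}.
    by apply: minset_exists; rewrite /bridge_set bA (subset_trans AB).
  have lL : L \in leaves by rewrite inE.
  have [_ _ /set0Pn[x Lx] _] := leafP lL.
  have := subsetP AB x (subsetP LA x Lx); rewrite EB inE => /andP[/bigcupP[]].
  by exists L.
move=> k1 A pA nA; case/setU1P: BW => [EB|/leafP[_ b1 _ _]]; last by rewrite b1 in k1.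
subst B.
(* Connectivity of [W] comes from that of [S]: [A] is enlarged by the leaves adjacent to it. The
   only edge out of such a leaf returns to [A], so an edge leaving [Y] must join [A] to
   [W :\: A]. *)
pose Y := A :|: cover [set L in leaves | [exists x in A, exists y in L, e x y]].
have AY : A \subset Y by apply: subsetUl.
have [[v u] /and3P[]|noedge] :=
  pickP [pred p : T * T | [&& p.1 \in A, p.2 \in W :\: A & e p.1 p.2]].
  by exists v, u.
have nWA v u : v \in A -> u \in W :\: A -> ~~ e v u.
  by move=> Av WAu; have := noedge (v, u); rewrite /= Av WAu /= => ->.
have [|| v [u [Yv /setDP[Su Yu] evu]]] := conn (A := Y).
- rewrite properE subUset (subset_trans (proper_sub pA)) //=; apply/andP; split.
    apply/bigcupsP=> L; rewrite inE => /andP[/leafP[]//].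
  have /properP[_ [w Ww nAw]] := pA; apply/subsetPn; exists w; first exact: (subsetP BS).
  rewrite inE (negbTE nAw); apply/bigcupP=> -[L]; rewrite inE => /andP[lL _] Lw.
  by move: Ww; rewrite inE => /andP[/bigcupP[]]; exists L.
- by have /set0Pn[x Ax] := nA; apply/set0Pn; exists x; rewrite inE Ax.
exfalso; move: Yv; rewrite inE => /orP[Av|/bigcupP[L]].
  have [|] := boolP (u \in cover leaves); last first.
    move=> nu; have := nWA v u Av; rewrite evu inE (contra (subsetP AY u)) // inE nu Su.
    by move/(_ isT).
  case/bigcupP=> L lL Lu; case/negP: Yu; rewrite inE; apply/orP; right.
  apply/bigcupP; exists L => //; rewrite inE lL; apply/exists_inP; exists v => //.
  by apply/exists_inP; exists u.
rewrite inE => /andP[lL /exists_inP[x Ax /exists_inP[y Ly exy]]] Lv.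
have [_ /eqP/cards1P[p Ep] _ _] := leafP lL.
have nLx : x \notin L.
  apply/negP=> Lx; have := subsetP (proper_sub pA) x Ax.
  by rewrite inE => /andP[/bigcupP[]]; exists L.
have LY : L \subset Y.
  apply/subsetP=> z Lz; rewrite inE; apply/orP; right; apply/bigcupP; exists L => //.
  by rewrite inE lL; apply/exists_inP; exists x => //; apply/exists_inP; exists y.
have : (y, x) \in boundary e L by apply/boundaryP; rewrite eC.
have : (v, u) \in boundary e L.
  by apply/boundaryP; split=> //; apply: contra Yu; apply: (subsetP LY).
rewrite Ep !inE => /eqP<- /eqP[_ Exu]; case/negP: Yu.
by rewrite -Exu (subsetP AY).
Qed.

Lemma connected_regular_split : exists h : rel T,
  [/\ symmetric h, subrel h e,
      forall v, v \in S -> deg h v = 2 \/ deg h v = d - 2 &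
      forall v u, h v u -> deg h v = deg h u].
Proof.
have /fin_all_exists[F FP] B : exists F : T -> T -> bool, B \in W |: leaves ->
    [/\ forall v, v \in B -> #|[set u | F v u]| = 2,
        forall v u, F v u -> v \in B /\ e v u,
        {in B &, forall v u, F v u = F u v} &
        forall v u, F v u -> #|boundary e B| = 1 -> u \in B].
  have [/piece_two_factor[F FP]|nBW] := boolP (B \in W |: leaves); first by exists F.
  by exists (fun _ _ => false).
pose piece v := if v \in W then W else pblock leaves v.
pose G v u := F (piece v) v u.
have notW v : v \in S -> v \notin W -> pblock leaves v \in leaves /\ v \in pblock leaves v.
  move=> Sv; rewrite /W in_setD Sv andbT negbK => cv.
  by rewrite pblock_mem // mem_pblock.
have leafW L v : L \in leaves -> v \in L -> v \notin W.
  move=> lL Lv; rewrite /W in_setD negb_and negbK; apply/orP; left.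
  by apply/bigcupP; exists L.
have pieceP v : v \in S -> piece v \in W |: leaves /\ v \in piece v.
  move=> Sv; rewrite /piece; case: ifP => Wv; first by rewrite setU11.
  by have [lv ->] := notW _ Sv (negbT Wv); rewrite setU1r.
have piece_leaf L v : L \in leaves -> v \in L -> piece v = L.
  move=> lL Lv; rewrite /piece (negbTE (leafW _ _ lL Lv)).
  exact: def_pblock trivIset_leaves lL Lv.
have piece_eq v u : v \in S -> u \in piece v -> piece u = piece v.
  move=> Sv; rewrite [in X in _ -> X]/piece /piece.
  case: (boolP (v \in W)) => [Wv -> //|nWv].
  have [lL Lv] := notW v Sv nWv => Lu.
  by have := piece_leaf _ _ lL Lu; rewrite /piece => ->.
have G2 v : v \in S -> #|[set u | G v u]| = 2.
  by move=> Sv; have [/FP[F2 _ _ _] pv] := pieceP v Sv; apply: F2.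
have Ge v u : v \in S -> G v u -> e v u.
  by move=> Sv; have [/FP[_ Fe _ _] _] := pieceP v Sv; case/Fe.
have GC v u : v \in S -> u \in piece v -> G v u = G u v.
  move=> Sv pu; have [/FP[_ _ FC _] pv] := pieceP v Sv.
  by rewrite /G (piece_eq v u Sv pu); apply: FC.
have Gleaf v u : v \in S -> v \notin W -> G v u -> u \in piece v.
  move=> Sv nWv Gvu; have [/FP[_ _ _ F1] pv] := pieceP v Sv.
  apply: F1 Gvu _; have [lL _] := notW v Sv nWv.
  by rewrite /piece (negbTE nWv); have [] := leafP lL.
pose big v := (v \in W) ||
  [exists p in W, [exists x in piece v, e p x && ~~ G p x]].
pose h v u := [&& e v u, big v == big u &
  if big v then ~~ G v u && ~~ G u v else G v u && G u v].
have hC : symmetric h.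
  move=> v u; rewrite /h eC [big u == _]eq_sym [G u v && _]andbC [~~ G u v && _]andbC.
  by case: eqP => [->|].
have big_leaf v u : v \in S -> v \notin W -> u \in piece v -> big u = big v.
  move=> Sv nWv pu; have [lL Lv] := notW v Sv nWv.
  have pE : piece v = pblock leaves v by rewrite /piece (negbTE nWv).
  rewrite /big (negbTE nWv) (negbTE (leafW _ _ lL _)) -?pE //.
  by rewrite (piece_eq v u Sv pu).
(* The two-sided conditions in [h] lose nothing: an edge that a big vertex does not select leads to
   a big vertex that does not select it either, and an edge selected at any other vertex stays
   inside its leaf. *)
have nb v : v \in S -> nbhd h v = if big v then nbhd e v :\: [set u | G v u] else [set u | G v u].
  move=> Sv; apply/setP=> u; case bv : (big v); rewrite !inE /h bv; last first.
    apply/and3P/idP=> [[_ _ /andP[]]//|Gvu].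
    have nWv : v \notin W by move: bv; rewrite /big; case: (v \in W).
    have pu := Gleaf v u Sv nWv Gvu.
    by rewrite (Ge _ _ Sv Gvu) (big_leaf v u) // bv -(GC v u Sv pu) Gvu.
  apply/and3P/andP=> [[evu _ /andP[nG _]]|[nG evu]] //.
  have /andP[_ Su] := edge_supp evu.
  suff [bu nG'] : big u /\ ~~ G u v by rewrite bu nG nG' evu.
  have [Wv|nWv] := boolP (v \in W).
    have [Wu|nWu] := boolP (u \in W).
      rewrite /big Wu; split=> //; rewrite -(GC v u) // /piece Wv //.
    have [_ pu] := pieceP u Su.
    split.
      rewrite /big; apply/orP; right; apply/exists_inP; exists v => //.
      by apply/exists_inP; exists u; rewrite // evu.
    apply: contraL Wv => /(Gleaf _ _ Su nWu); have [lL _] := notW u Su nWu.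
    by rewrite /piece (negbTE nWu); apply: leafW.
  have [lL Lv] := notW v Sv nWv.
  have pE : piece v = pblock leaves v by rewrite /piece (negbTE nWv).
  have [pu|npu] := boolP (u \in piece v).
    by rewrite (big_leaf v u) // bv -(GC v u).
  (* The edge from [v] to [u] leaves its leaf, so it is the unique outgoing edge, the one that made
     the leaf big; hence [u] is [p]. *)
  move: bv; rewrite /big (negbTE nWv) => /exists_inP[p Wp /exists_inP[x px /andP[epx nGpx]]].
  have [_ /eqP/cards1P[q Eq] _ _] := leafP lL.
  have : (v, u) \in boundary e (pblock leaves v) by apply/boundaryP; split; rewrite // -pE.
  have : (x, p) \in boundary e (pblock leaves v).
    apply/boundaryP; rewrite -pE eC; split=> //; apply: contraL Wp; rewrite pE.
    exact: leafW.
  by rewrite Eq => /set1P<- /set1P[-> ->]; rewrite /big Wp.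
exists h; split=> // [v u /and3P[]//|v Sv|v u hvu].
- rewrite /deg nb //; case: ifP => _; last by left; apply: G2.
  right; rewrite cardsD -/(deg e v) degS // (setIidPr _) ?G2 //.
  by apply/subsetP=> u; rewrite !inE; apply: Ge.
have /and3P[evu /eqP bvu _] := hvu; have /andP[Sv Su] := edge_supp evu.
rewrite /deg !nb // bvu; case: ifP => _; last by rewrite !G2.
rewrite !cardsD -/(deg e v) -/(deg e u) !degS //.
by rewrite !(setIidPr _) ?G2 //; apply/subsetP=> y; rewrite !inE; apply: Ge.
Qed.
End Step.

(** Reduction to a connected support: a separating set [A] cuts [e] into two graphs, each with fewer
    vertices of degree [d]. *)
Lemma regular_split (T : finType) (e : rel T) d :
  symmetric e -> irreflexive e -> 5 <= d -> odd d ->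
  (forall v, deg e v = d \/ deg e v = 0) ->
  exists h : rel T,
  [/\ symmetric h, subrel h e,
      forall v, deg e v = d -> deg h v = 2 \/ deg h v = d - 2 &
      forall v u, h v u -> deg h v = deg h u].
Proof.
move=> + + d5 od.
have [n] := ubnP #|[set v | deg e v == d]|; elim: n e => // n IHn e.
set S := [set v | _] => ltS eC e0 degE.
have eS v u : e v u -> v \in S.
  move=> evu; rewrite inE; case: (degE v) => [->//|/eqP]; rewrite cards_eq0 => /eqP N0.
  have : u \in nbhd e v by rewrite inE.
  by rewrite N0 inE.
pose sep (A : {set T}) := [&& A \proper S, A != set0 &
  [forall v in A, forall u in S :\: A, ~~ e v u]].
have [A /and3P[pA nA /forall_inP noE]|conn] := pickP sep; last first.
  have [||h [hC he h2 hh]] := @connected_regular_split T e d eC e0 d5 od.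
  - by move=> v; rewrite inE; case: (degE v) => [->|]; rewrite ?eqxx.
  - move=> A pA nA; have := conn A; rewrite /sep pA nA /= => /negbT.
    rewrite negb_forall => /existsP[v]; rewrite negb_imply => /andP[Av].
    rewrite negb_forall => /existsP[u]; rewrite negb_imply negbK => /andP[Su evu].
    by exists v, u.
  by exists h; split=> // v dv; apply: h2; rewrite inE dv.
have AS := proper_sub pA.
have clA v u : e v u -> (v \in A) = (u \in A).
  suff sub x y : e x y -> x \in A -> y \in A.
    by move=> evu; apply/idP/idP; apply: sub; rewrite // eC.
  move=> exy Ax; have /forall_inP/(_ y) := noE x Ax; rewrite inE exy /=.
  have -> : y \in S by apply: (eS y x); rewrite eC.
  by rewrite andbT; case: (y \in A) => // /(_ isT).
have part (X : {set T}) : (forall v u, e v u -> (v \in X) = (u \in X)) ->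
    (exists v, v \in S :\: X) -> exists h : rel T,
    [/\ symmetric h, subrel h e,
      forall v, v \in X -> deg e v = d -> deg h v = 2 \/ deg h v = d - 2 &
      forall v u, h v u -> deg h v = deg h u].
  move=> clX [x /setDP[Sx nXx]]; pose f v u := e v u && (v \in X).
  have degf v : deg f v = if v \in X then deg e v else 0.
    rewrite /deg; case: ifP => Xv.
      by apply: eq_card => u; rewrite !inE /f Xv andbT.
    by apply/eqP; rewrite cards_eq0; apply/eqP/setP=> u; rewrite !inE /f Xv andbF.
  have [||||h [hC hf h2 hh]] := IHn f.
  - rewrite -ltnS (leq_trans _ ltS) // ltnS; apply: proper_card; apply/properP; split.
      apply/subsetP=> v; rewrite !inE degf; case: ifP => // _.
      by rewrite eq_sym; case: (d) d5.
    by exists x; rewrite // inE degf (negbTE nXx) eq_sym; case: (d) d5.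
  - by move=> v u; rewrite /f eC; case evu : (e u v) => //; rewrite (clX u v).
  - by move=> v; rewrite /f e0.
  - by move=> v; rewrite degf; case: ifP => // _; right.
  exists h; split=> // [v u /hf/andP[]//|v Xv dv].
  by apply: h2; rewrite degf Xv.
have [|h1 [h1C h1e h12 h1h]] := part A clA.
  by have /properP[_ [v Sv nAv]] := pA; exists v; rewrite inE nAv.
have [||h2 [h2C h2e h22 h2h]] := part (~: A).
- by move=> v u /clA; rewrite !inE => ->.
- by have /set0Pn[v Av] := nA; exists v; rewrite in_setD (subsetP AS) // inE negbK Av.
pose h v u := if v \in A then h1 v u else h2 v u.
have degh v : deg h v = if v \in A then deg h1 v else deg h2 v.
  by rewrite /deg; case Av: (v \in A); apply: eq_card => u; rewrite !inE /h Av.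
have he : subrel h e by move=> v u; rewrite /h; case: ifP => _; [apply: h1e|apply: h2e].
exists h; split=> // [v u|v dv|v u hvu].
- case evu : (e v u); first by rewrite /h (clA v u evu) h1C h2C.
  have nh x y : e x y = false -> h x y = false by apply: contraFF; apply: he.
  by rewrite !nh // eC.
- rewrite degh; case: ifP => Av; first exact: h12.
  by apply: h22; rewrite // inE Av.
rewrite !degh -(clA v u (he _ _ hvu)); move: hvu; rewrite /h.
by case: ifP => _; [apply: h1h|apply: h2h].
Qed.

(** Each split lowers [d] by two and keeps it odd, so the descent ends at 3. Vertices that have
    reached degree 2 become isolated in the graph [f] passed on, whence the alternative of degree
    0. *)
Theorem regular_2_3_factor (T : finType) (e : rel T) d :
  symmetric e -> irreflexive e -> 3 <= d -> odd d ->
  (forall v, deg e v = d \/ deg e v = 0) ->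
  exists h : rel T,
  [/\ symmetric h, subrel h e,
      forall v, deg e v = d -> deg h v = 2 \/ deg h v = 3 &
      forall v u, h v u -> deg h v = deg h u].
Proof.
have [n] := ubnP d; elim: n e d => // n IHn e d ltd eC e0 d3 od degE.
have [d_eq3|d_neq3] := eqVneq d 3.
  exists e; split=> // [v ->|v u evu]; first by right.
  have dd x y : e x y -> deg e x = d.
    move=> exy; case: (degE x) => // /eqP; rewrite cards_eq0 => /eqP N0.
    have : y \in nbhd e x by rewrite inE.
    by rewrite N0 inE.
  by rewrite (dd v u) ?(dd u v) // eC.
have d5 : 5 <= d.
  by move: d3 od d_neq3; case: (d) => [|[|[|[|[|d']]]]].
have [h [hC he h2 hh]] := regular_split eC e0 d5 od degE.
pose f v u := h v u && (deg h v == d - 2).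
have degf v : deg f v = if deg h v == d - 2 then d - 2 else 0.
  case: eqP => [E|/eqP/negbTE nd].
    by rewrite -[RHS]E; apply: eq_card => u; rewrite !inE /f E eqxx andbT.
  by apply/eqP; rewrite cards_eq0; apply/eqP/setP=> u; rewrite !inE /f nd andbF.
have [||||||g [gC gf g23 gh]] := IHn f (d - 2).
- by rewrite -ltnS (leq_trans _ ltd) // ltnS ltn_subrL (leq_trans _ d3).
- move=> v u; rewrite /f hC; case huv : (h u v) => //=.
  by rewrite (hh u v).
- by move=> v; rewrite /f; case hvv : (h v v) => //; move: (he v v hvv); rewrite e0.
- by move: d5; clear; lia.
- by rewrite oddB ?od // (leq_trans _ d3).
- by move=> v; rewrite degf; case: ifP; [left|right].
pose k v u := if deg h v == 2 then h v u else g v u.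
have degk v : deg k v = if deg h v == 2 then 2 else deg g v.
  case: eqP => [E|/eqP/negbTE nd].
    by rewrite -[RHS]E; apply: eq_card => u; rewrite !inE /k E.
  by apply: eq_card => u; rewrite !inE /k nd.
have kh : subrel k h.
  by move=> v u; rewrite /k; case: ifP => // _ /gf/andP[].
exists k; split=> [v u|v u /kh/he//|v dv|v u kvu].
- case hvu : (h v u); first by rewrite /k (hh v u hvu) hC gC.
  have nk x y : h x y = false -> k x y = false by apply: contraFF; apply: kh.
  by rewrite !nk // hC.
- rewrite degk; case: eqP => [_|n2v]; first by left.
  by apply: g23; rewrite degf; case: (h2 v dv) => [//|->]; rewrite eqxx.
rewrite !degk -(hh v u (kh _ _ kvu)); move: kvu; rewrite /k.
by case: ifP => // _; apply: gh.
Qed.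

(** * Packings of even stars and of K_{2,3} *)

Lemma subset_of_card (T : finType) (A : {set T}) n :
  n <= #|A| -> exists2 X : {set T}, X \subset A & #|X| = n.
Proof.
case/card_geqP=> s [us <- sA]; exists [set x in s].
  by apply/subsetP=> x; rewrite inE => /sA.
by rewrite cardsE; apply/card_uniqP.
Qed.

Lemma disjoint_setU (T : finType) (A B C : {set T}) :
  [disjoint A :|: B & C] = [disjoint A & C] && [disjoint B & C].
Proof. by rewrite !disjoints_subset subUset. Qed.

Section Blocks.
Variables (T : finType) (e : rel T).
Hypotheses (eC : symmetric e) (e0 : irreflexive e).
Implicit Types (B D L : {set T}) (P : {set {set T}}).

(** Edges inside either side are allowed, since only the complete bipartite graph between the sides
    will be used. *)
Definition joined D B :=
  (D \subset B) && [forall x in D, forall y in B :\: D, e x y].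

Definition star B := [&& odd #|B|, 1 < #|B| & [exists c, joined [set c] B]].
Definition K23 B := (#|B| == 5) && [exists D : {set T}, (#|D| == 2) && joined D B].
Definition triangle B := (#|B| == 3) && [forall c in B, joined [set c] B].

(* Twice the number of edges of the complete bipartite graph spanning the block,
   the extra unit making triangles preferred to induced paths. *)
Definition value B :=
  if K23 B then 12 else if star B then (#|B|.-1) * 2 + triangle B else 0.

Lemma joinedP D B :
  reflect (D \subset B /\ forall x y, x \in D -> y \in B -> y \notin D -> e x y)
          (joined D B).
Proof.
apply: (iffP andP) => -[DB]; split=> //.
  move=> x y Dx By nDy; have /forall_inP/(_ x Dx)/forall_inP := b.
  by apply; rewrite inE nDy.
apply/forall_inP=> x Dx; apply/forall_inP=> y /setDP[By nDy].
exact: b.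
Qed.

Lemma value_star c L : c \notin L -> (forall v, v \in L -> e c v) ->
  ~~ odd #|L| -> 0 < #|L| -> #|L| * 2 <= value (c |: L).
Proof.
move=> cL ecL oL L0; have cB : #|c |: L| = #|L|.+1 by rewrite cardsU1 cL.
rewrite /value /K23 cB; case: ifP => [/andP[/eqP[->]]//|_].
have -> : star (c |: L) = true.
  rewrite /star cB /= oL ltnS L0; apply/existsP; exists c; apply/joinedP.
  split=> [|x y]; first by rewrite sub1set setU11.
  by rewrite !inE => /eqP-> /orP[->//|Ly] _; apply: ecL.
by rewrite leq_addr.
Qed.

Lemma value_path p q r : p != r -> e q p -> e q r -> 4 <= value [set p; q; r].
Proof.
move=> npr eqp eqr.
have -> : [set p; q; r] = q |: [set p; r].
  by apply/setP=> x; rewrite !inE orbA [(x == p) || _]orbC.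
have /= := @value_star q [set p; r]; rewrite cards2 npr; apply=> // [|v].
  by rewrite !inE negb_or; apply/andP; split; apply: contraTneq isT => E;
     [move: eqp|move: eqr]; rewrite E e0.
by rewrite !inE => /orP[] /eqP->.
Qed.

Lemma value_star4 c x y z w : uniq [:: x; y; z; w] ->
  e c x -> e c y -> e c z -> e c w -> 8 <= value (c |: [set x; y; z; w]).
Proof.
move=> u ex ey ez ew.
have c4 : #|[set x; y; z; w]| = 4.
  rewrite -[4]/(size [:: x; y; z; w]) -(card_uniqP u); apply: eq_card => v.
  by rewrite !inE !orbA.
have := @value_star c [set x; y; z; w]; rewrite c4; apply=> // [|v].
  by apply/negP; rewrite !inE -!orbA => /or4P[] /eqP E; [move: ex|move: ey|move: ez|move: ew];
    rewrite -E e0.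
by rewrite !inE -!orbA => /or4P[] /eqP->.
Qed.

Lemma value_triangle x y z : e x y -> e y z -> e x z -> 5 <= value [set x; y; z].
Proof.
move=> exy eyz exz.
have n u v : e u v -> u != v by apply: contraTneq => ->; rewrite e0.
have c3 : #|[set x; y; z]| = 3.
  by rewrite -setUA cardsU1 cards2 !inE negb_or !n.
have jn c : c \in [set x; y; z] -> joined [set c] [set x; y; z].
  move=> cB; apply/joinedP; split=> [|c' v]; first by rewrite sub1set.
  rewrite inE => /eqP->; move: cB; rewrite !inE -!orbA.
  by case/or3P=> /eqP-> /or3P[] /eqP->; rewrite ?eqxx // eC.
rewrite /value /K23 /star /triangle c3 /=.
have -> : [exists c, joined [set c] [set x; y; z]].
  by apply/existsP; exists x; apply: jn; rewrite !inE eqxx.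
by have -> : [forall c in [set x; y; z], joined [set c] [set x; y; z]] by apply/forall_inP.
Qed.

Lemma value_K23 D L : #|D| = 2 -> #|L| = 3 -> (forall x y, x \in D -> y \in L -> e x y) ->
  value (D :|: L) = 12.
Proof.
move=> D2 L3 eDL; rewrite /value; have -> // : K23 (D :|: L) = true.
have dDL : [disjoint D & L].
  rewrite disjoint_subset; apply/subsetP=> x Dx; rewrite inE; apply/negP=> /(eDL _ _ Dx).
  by rewrite e0.
rewrite /K23 cardsU (disjoint_setI0 dDL) cards0 D2 L3 /=; apply/existsP; exists D.
rewrite D2 /=; apply/joinedP; split=> [|x y Dx]; first exact: subsetUl.
by rewrite inE => /orP[->//|Ly] _; apply: eDL.
Qed.

Lemma value0 : value set0 = 0.
Proof. by rewrite /value /K23 /star cards0. Qed.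

Definition packing P := trivIset P && [forall B in P, 0 < value B].
Definition packing_value P := \sum_(B in P) value B.

(** A set of value 0 leaves the packing unchanged, so exchanges may also use sets that are not
    blocks, such as [set0]. *)
Lemma packing_add P B : packing P -> [disjoint B & cover P] ->
  exists P', [/\ packing P', cover P' \subset B :|: cover P &
                 value B + packing_value P <= packing_value P'].
Proof.
move=> /andP[tP /forall_inP vP] dB.
have [vB|vB] := posnP (value B).
  by exists P; rewrite vB subsetUr /packing tP; split=> //; apply/forall_inP.
have dBC C : C \in P -> [disjoint B & C].
  by move=> CP; apply: disjointWr dB; apply: bigcup_sup CP.
have nB : B \notin P.
  apply/negP=> /dBC; rewrite -setI_eq0 setIid => /eqP B0.
  by rewrite B0 value0 in vB.
exists (B |: P); split; last by rewrite /packing_value big_setU1.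
  apply/andP; split; last by apply/forall_inP=> C /setU1P[->|/vP].
  apply/trivIsetP=> C1 C2 /setU1P[->|C1P] /setU1P[->|C2P].
  - by rewrite eqxx.
  - by rewrite dBC.
  - by rewrite disjoint_sym dBC.
  by move/trivIsetP: tP; apply.
by rewrite /cover big_setU1.
Qed.

(** * Exchanges in a packing of maximum value *)

Section Maximal.
Variable P : {set {set T}}.
Hypothesis packP : packing P.
Hypothesis maxP : forall P', packing P' -> packing_value P' <= packing_value P.
Let R := ~: cover P.

Lemma free_block B : B \subset R -> value B = 0.
Proof.
move=> BR; have [|P' [packP' _ le]] := packing_add (B := B) packP.
  by rewrite disjoints_subset.
by apply/eqP; rewrite -leqn0 -(leq_add2r (packing_value P)) (leq_trans le) ?maxP.
Qed.

Lemma exchange3 B B1 B2 B3 : B \in P ->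
  B1 \subset B :|: R -> B2 \subset B :|: R -> B3 \subset B :|: R ->
  [disjoint B1 & B2] -> [disjoint B1 & B3] -> [disjoint B2 & B3] ->
  value B1 + value B2 + value B3 <= value B.
Proof.
move=> BP s1 s2 s3 d12 d13 d23.
have /andP[tP /forall_inP vP] := packP.
have pack0 : packing (P :\ B).
  apply/andP; split; first by apply: trivIsetS tP; apply: subD1set.
  by apply/forall_inP=> C /setD1P[_ /vP].
have dBR : [disjoint B :|: R & cover (P :\ B)].
  apply: bigcup_disjoint => C /setD1P[nC CP]; rewrite disjoint_setU; apply/andP; split.
    by move/trivIsetP: tP; apply; rewrite // eq_sym.
  by rewrite disjoint_sym disjoints_subset setCK; apply: bigcup_sup CP.
have [|P1 [pack1 c1 v1]] := packing_add (B := B1) pack0; first exact: disjointWl dBR.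
have [|P2 [pack2 c2 v2]] := packing_add (B := B2) pack1.
  by apply: disjointWr c1 _; rewrite disjoint_sym disjoint_setU d12 disjoint_sym (disjointWl s2).
have [|P3 [pack3 c3 v3]] := packing_add (B := B3) pack2.
  apply: disjointWr c2 _; rewrite disjoint_sym disjoint_setU d23 /= disjoint_sym.
  by apply: disjointWr c1 _; rewrite disjoint_sym disjoint_setU d13 disjoint_sym (disjointWl s3).
have := maxP pack3; have -> : packing_value P = value B + packing_value (P :\ B).
  by rewrite /packing_value (big_setD1 B).
by move: v1 v2 v3; clear; lia.
Qed.

Lemma exchange2 B B1 B2 : B \in P ->
  B1 \subset B :|: R -> B2 \subset B :|: R -> [disjoint B1 & B2] ->
  value B1 + value B2 <= value B.
Proof.
move=> BP s1 s2 d12; have := @exchange3 B B1 B2 set0; rewrite value0 addn0.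
by apply; rewrite ?sub0set // disjoints_subset ?setC0 ?subsetT.
Qed.

Lemma exchange1 B B1 : B \in P -> B1 \subset B :|: R -> value B1 <= value B.
Proof.
move=> BP s1; have := @exchange2 B B1 set0; rewrite value0 addn0.
by apply; rewrite ?sub0set // disjoints_subset ?setC0 ?subsetT.
Qed.

(** * Discharging the uncovered vertices onto the blocks *)

Section Charges.
Variable d : nat.
Hypotheses (d_ge4 : 4 <= d) (degE : forall v, deg e v = d).

Let N v := nbhd e v :&: R.
(* An uncovered vertex x sends load x along each edge to a covered vertex: a total
   of d * (d - 1), since it has at most one uncovered neighbour. *)
Let load x := if N x == set0 then d.-1 else d.
Let charge B := \sum_(v in B) \sum_(x in N v) load x.
(** Twice the edges minus the order: the number of uncovered vertices that the block can pay for. *)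
Let size_bound B := (if K23 B then 6 else #|B|.-1) * 2 - #|B|.

Let NP v x : x \in N v = e v x && (x \in R). Proof. by rewrite !inE. Qed.

Lemma block_free B v x : B \in P -> v \in B -> x \in R -> v != x.
Proof.
move=> BP Bv Rx; apply: contraTneq Rx => <-; rewrite inE negbK.
by apply/bigcupP; exists B.
Qed.

Lemma free_degree x : x \in R -> #|N x| <= 1.
Proof.
move=> Rx; rewrite leqNgt; apply/negP=> /card_gt1P[u [v [xu xv nuv]]].
move: xu xv; rewrite !NP => /andP[exu Ru] /andP[exv Rv].
have := value_path nuv exu exv; rewrite free_block //.
by apply/subsetP=> y; rewrite !in_setU !in_set1 => /orP[/orP[]|] /eqP->.
Qed.

Lemma load_le x : load x <= d.
Proof. by rewrite /load; case: ifP => // _; apply: leq_pred. Qed.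

Lemma sum_charge : \sum_(B in P) charge B = #|R| * (d * d.-1).
Proof.
have /andP[tP _] := packP.
have := @big_trivIset _ _ _ _ P (fun v => \sum_(x in N v) load x) tP.
rewrite /= => <-; rewrite -sum_nat_const.
rewrite (eq_bigr (fun v => \sum_(x in R | e v x) load x)); last first.
  by move=> v _; apply: eq_bigl => x; rewrite NP andbC.
rewrite (exchange_big_dep (mem R)) /=; last by move=> v x _ /andP[].
apply: eq_bigr => x Rx; rewrite sum_nat_const.
have cN : #|[set v in cover P | e v x]| + #|N x| = d.
  rewrite -(degE x) /deg -(cardsID R (nbhd e x)) addnC; congr (_ + _).
  by apply: eq_card => v; rewrite !inE negbK eC andbC.
have -> : #|[pred v | (v \in cover P) && ((x \in R) && e v x)]| = #|[set v in cover P | e v x]|.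
  by apply: eq_card => v; rewrite [in RHS]inE unfold_in /= Rx.
have := free_degree Rx; rewrite /load -cards_eq0; move: cN.
case: #|N x| => [|[|//]] /=; first by rewrite addn0 => -> _; rewrite mulnC.
by rewrite addn1 => <- _; rewrite mulnC.
Qed.

Lemma charge_le B : charge B <= d * \sum_(v in B) #|N v|.
Proof.
rewrite big_distrr /=; apply: leq_sum => v _; rewrite mulnC -sum_nat_const.
by apply: leq_sum => x _; apply: load_le.
Qed.

Lemma free_nbrs_le B v (X : {set T}) : B \in P -> X \subset B -> (forall u, u \in X -> e v u) ->
  #|N v| + #|X| <= d.
Proof.
move=> BP XB evX; rewrite -(degE v) /deg.
have dNX : [disjoint N v & X].
  rewrite disjoint_sym disjoints_subset; apply/subsetP=> u /(subsetP XB) Bu; rewrite inE NP negb_and.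
  by apply/orP; right; apply/negP=> /(block_free BP Bu); rewrite eqxx.
have -> : #|N v| + #|X| = #|N v :|: X| by rewrite cardsU (disjoint_setI0 dNX) cards0 subn0.
apply: subset_leq_card; apply/subsetP=> u; rewrite inE NP.
by case/orP=> [/andP[evu _]|/evX evu]; rewrite inE.
Qed.

(** Every vertex of the block has at least two neighbours in it, and [5 * (d - 2) <= 7 * (d - 1)],
    where 7 is 12 - 5. *)
Lemma charge_K23 B : B \in P -> K23 B -> charge B <= d * d.-1 * size_bound B.
Proof.
move=> BP kB; rewrite /size_bound kB; have /andP[/eqP B5 /existsP[D /andP[/eqP D2 /joinedP[DB jD]]]] := kB.
apply: leq_trans (charge_le B) _; rewrite B5 -mulnA leq_mul2l; apply/orP; right.
have BD3 : #|B :\: D| = 3 by rewrite cardsD (setIidPr DB) B5 D2.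
apply: leq_trans (_ : \sum_(v in B) (d - 2) <= _); last first.
  by rewrite sum_nat_const B5; move: d_ge4; clear; lia.
apply: leq_sum => v Bv; have [Dv|nDv] := boolP (v \in D).
  have := free_nbrs_le (v := v) BP (subsetDl B D); rewrite BD3.
  have H u : u \in B :\: D -> e v u by move=> /setDP[Bu nDu]; apply: jD.
  by move/(_ H); move: d_ge4; clear; lia.
have := free_nbrs_le (v := v) BP DB; rewrite D2.
have H u : u \in D -> e v u by move=> Du; rewrite eC; apply: jD.
by move/(_ H); move: d_ge4; clear; lia.
Qed.

Section Star.
Variables (B : {set T}) (c : T).
Hypotheses (BP : B \in P) (nK : ~~ K23 B) (oB : odd #|B|) (B_gt1 : 1 < #|B|).
Hypotheses (Bc : c \in B) (ecB : forall v, v \in B -> v != c -> e c v).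
Let L := B :\ c.

Let BE : B = c |: L. Proof. by rewrite setD1K. Qed.
Let cL : c \notin L. Proof. by rewrite !inE eqxx. Qed.
Let cardB : #|B| = #|L|.+1. Proof. by rewrite {1}BE cardsU1 cL. Qed.
Let ecL v : v \in L -> e c v. Proof. by case/setD1P=> nv Bv; apply: ecB. Qed.
Let LB v : v \in L -> v \in B. Proof. by case/setD1P. Qed.
Let L_ge2 : 2 <= #|L|.
Proof. by move: oB B_gt1; rewrite cardB; case: #|_| => [|[|]]. Qed.
Let evL : ~~ odd #|L|. Proof. by move: oB; rewrite cardB. Qed.
Let BR v : v \in B -> v \in B :|: R. Proof. by rewrite in_setU => ->. Qed.
Let nBR v x : v \in B -> x \in R -> v != x. Proof. exact: block_free. Qed.

Lemma value_block : value B <= #|L| * 2 + (#|B| == 3).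
Proof.
rewrite /value (negbTE nK); case: ifP => // _.
rewrite cardB /= leq_add2l /triangle cardB.
by case: (#|L|.+1 == 3) => //=; apply: leq_b1.
Qed.

(** Two free neighbours would become two new leaves; the gain of 4 exceeds the possible loss of the
    triangle unit. *)
Lemma center_free : #|N c| <= 1.
Proof.
rewrite leqNgt; apply/negP=> /subset_of_card[X XN X2].
have XR x : x \in X -> x \in R by move/(subsetP XN); rewrite NP => /andP[].
have dLX : [disjoint L & X].
  rewrite disjoints_subset; apply/subsetP=> v /LB Bv; rewrite inE.
  by apply/negP=> /XR/(nBR Bv); rewrite eqxx.
have cLX : #|L :|: X| = #|L| + 2 by rewrite cardsU (disjoint_setI0 dLX) cards0 subn0 X2.
have := @value_star c (L :|: X); rewrite cLX => le.
have : (#|L| + 2) * 2 <= value (c |: (L :|: X)).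
  apply: le => [|v||]; rewrite ?addn2 //=; last by rewrite negbK.
    by rewrite inE negb_or cL; apply/negP=> /XR/(nBR Bc); rewrite eqxx.
  by rewrite inE => /orP[/ecL//|/(subsetP XN)]; rewrite NP => /andP[].
have le2 : value (B :|: X) <= value B.
  by apply: exchange1 => //; rewrite setUS //; apply/subsetP=> x /XR.
rewrite setUA -BE => le3; have := leq_trans (leq_trans le3 le2) value_block.
by case: (#|B| == 3); clear; lia.
Qed.

Let dBR (Y X : {set T}) : Y \subset B -> X \subset R -> [disjoint Y & X].
Proof.
move=> YB XR; rewrite disjoints_subset; apply/subsetP=> v /(subsetP YB) Bv.
by rewrite inE; apply/negP=> /(subsetP XR)/(nBR Bv); rewrite eqxx.
Qed.

Let NR v : N v \subset R. Proof. exact: subsetIr. Qed.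
Let sRB (X : {set T}) : X \subset R -> X \subset B :|: R.
Proof. by move=> XR; apply: subset_trans XR (subsetUr _ _). Qed.
Let sBB (X : {set T}) : X \subset B -> X \subset B :|: R.
Proof. by move=> XB; apply: subset_trans XB (subsetUl _ _). Qed.

Let value_outer v (X : {set T}) : v \in B -> X \subset N v -> ~~ odd #|X| -> 0 < #|X| ->
  v |: X \subset B :|: R /\ #|X| * 2 <= value (v |: X).
Proof.
move=> Bv XN oX X0; have XR : X \subset R := subset_trans XN (NR v).
split; first by rewrite subUset sub1set BR //= sRB.
apply: value_star => // [|x /(subsetP XN)]; last by rewrite NP => /andP[].
by apply/negP=> /(subsetP XR)/(nBR Bv); rewrite eqxx.
Qed.

Let value_inner (X : {set T}) : X \subset L -> ~~ odd #|X| ->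
  B :\: X \subset B :|: R /\ (#|L| - #|X|) * 2 <= value (B :\: X).
Proof.
move=> XL oX; split; first by rewrite sBB ?subsetDl.
have cLX : #|L :\: X| = #|L| - #|X| by rewrite cardsD (setIidPr XL).
have [->//|LX0] := posnP (#|L| - #|X|).
have -> : B :\: X = c |: (L :\: X).
  apply/setP=> v; rewrite !inE; have [->|] //= := eqVneq v c.
  by rewrite Bc andbT; apply/negP=> /(subsetP XL); rewrite (negbTE cL).
rewrite -cLX; apply: value_star; rewrite ?cLX //.
- by rewrite inE (negbTE cL) andbF.
- by move=> v /setDP[/ecL].
by rewrite oddB ?subset_leq_card // (negbTE evL).
Qed.

(** Four free neighbours would form a star of value 8 at [v], while giving up [v] and one more leaf,
    to keep the number of leaves even, costs 4. *)
Lemma leaf_free4 v : #|B| != 3 -> v \in L -> #|N v| <= 3.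
Proof.
move=> B3 Lv; rewrite leqNgt; apply/negP=> /subset_of_card[X XN X4].
have Bv := LB Lv.
have [||s1 v1] := value_outer Bv XN; rewrite ?X4 //.
rewrite X4 in v1.
have L4 : 4 <= #|L|.
  by move: B3 L_ge2 evL; rewrite cardB; case: #|_| => [|[|[|[]]]].
have [u Lu nuv] : exists2 u, u \in L & u != v.
  have : 0 < #|L :\ v| by rewrite -(ltn_add2l 1) -[X in X + #|L :\ v|]/(true : nat) -Lv -cardsD1 (leq_trans _ L4).
  by case/card_gt0P=> u /setD1P[nuv Lu]; exists u.
have sX : [set v; u] \subset L by rewrite subUset !sub1set Lv.
have [|s2 v2] := value_inner sX; rewrite ?cards2 1?[v == u]eq_sym ?nuv //.
rewrite cards2 eq_sym nuv in v2.
have := exchange2 BP s1 s2; have := value_block; rewrite (negbTE B3) addn0.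
have -> : [disjoint v |: X & B :\: [set v; u]].
  rewrite disjoint_setU disjoints1 !inE eqxx /= disjoint_sym.
  by apply: dBR; [apply: subsetDl | apply: subset_trans XN (NR v)].
by move=> + /(_ isT); move: v1 v2 L4; clear; lia.
Qed.

(** Three free neighbours and [c] would form a star of value 8 at [v], against at most 5 for [B]. *)
Lemma leaf_free3 v : #|B| = 3 -> v \in L -> #|N v| <= 2.
Proof.
move=> B3 Lv; rewrite leqNgt; apply/negP=> /subset_of_card[X XN X3].
have Bv := LB Lv; have XR : X \subset R := subset_trans XN (NR v).
have cX : c \notin X by apply/negP=> /(subsetP XR)/(nBR Bc); rewrite eqxx.
have vc : v != c by case/setD1P: Lv.
have s1 : v |: (c |: X) \subset B :|: R.
  by rewrite !subUset !sub1set !BR //= sRB.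
have := @value_star v (c |: X); rewrite cardsU1 cX X3 => /(_ _ _ isT isT) v1.
have {v1} : 8 <= value (v |: (c |: X)).
  apply: v1 => [|u]; rewrite in_setU1.
    by rewrite negb_or vc; apply/negP=> /(subsetP XR)/(nBR Bv); rewrite eqxx.
  by case/predU1P=> [->|/(subsetP XN)]; [rewrite eC ecL | rewrite NP => /andP[]].
have := exchange1 BP s1; have := value_block; rewrite B3 /=.
by move: B3; rewrite cardB; clear; lia.
Qed.

(** [B] has value 8. If [v] keeps two free neighbours outside the pair [X] of [u], there are three
    disjoint paths, centred at [v], [u] and [c], of total value 12. Otherwise [X] lies in [N v], and
    [v], [u] against [c |: X] is a K_{2,3}, again of value 12. *)
Lemma two_leaves v u : #|B| = 5 -> v \in L -> u \in L -> v != u ->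
  3 <= #|N v| -> 2 <= #|N u| -> False.
Proof.
move=> B5 Lv Lu nvu Nv /subset_of_card[X XN X2].
have L4 : #|L| = 4 by move: B5; rewrite cardB => -[].
have vB : value B <= 8 by have := value_block; rewrite B5 L4.
have [Bv Bu] := (LB Lv, LB Lu).
have XR : X \subset R := subset_trans XN (NR u).
have [|lt2] := leqP 2 #|N v :\: X|.
  case/subset_of_card=> Y /subsetDP[YN dYX] Y2.
  have [||s1 v1] := value_outer Bv YN; rewrite ?Y2 //.
  rewrite Y2 in v1.
  have [||s2 v2] := value_outer Bu XN; rewrite ?X2 //.
  rewrite X2 in v2.
  have sX : [set v; u] \subset L by rewrite subUset !sub1set Lv.
  have [|s3 v3] := value_inner sX; rewrite ?cards2 ?nvu //.
  rewrite cards2 nvu in v3.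
  have YR : Y \subset R := subset_trans YN (NR v).
  have := exchange3 BP s1 s2 s3; have -> : [disjoint v |: Y & u |: X].
    rewrite disjoint_setU disjoints1 in_setU1 negb_or nvu /=; apply/andP; split.
      by apply/negP=> /(subsetP XR)/(nBR Bv); rewrite eqxx.
    rewrite disjoint_sym disjoint_setU disjoints1 disjoint_sym dYX andbT.
    by apply/negP=> /(subsetP YR)/(nBR Bu); rewrite eqxx.
  have -> : [disjoint v |: Y & B :\: [set v; u]].
    by rewrite disjoint_setU disjoints1 !inE eqxx /= disjoint_sym dBR ?subsetDl.
  have -> : [disjoint u |: X & B :\: [set v; u]].
    by rewrite disjoint_setU disjoints1 !inE eqxx orbT /= disjoint_sym dBR ?subsetDl.
  by move=> /(_ isT isT isT); move: v1 v2 v3 vB; rewrite L4; clear; lia.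
have XNv : X \subset N v.
  apply/setIidPr/eqP; rewrite eqEcard subsetIr X2.
  by move: Nv lt2; rewrite -(cardsID X (N v)) setIC; clear; lia.
have cX : c \notin X by apply/negP=> /(subsetP XR)/(nBR Bc); rewrite eqxx.
have : value ([set v; u] :|: (c |: X)) <= value B.
  by apply: exchange1; rewrite // !subUset !sub1set !BR //= sRB.
rewrite value_K23 ?cards2 ?nvu ?cardsU1 ?cX ?X2 // => [|x y].
  by move: vB; clear; lia.
rewrite in_set2 in_setU1 => /orP[]/eqP-> /predU1P[->|Xy]; rewrite 1?eC ?ecL //.
  by have := subsetP XNv y Xy; rewrite NP eC => /andP[].
by have := subsetP XN y Xy; rewrite NP eC => /andP[].
Qed.

Lemma size_bound_star : size_bound B = #|L|.-1.
Proof. by rewrite /size_bound (negbTE nK) cardB /=; clear; lia. Qed.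

Lemma sum_free_split : \sum_(v in B) #|N v| = #|N c| + \sum_(v in L) #|N v|.
Proof. by rewrite (big_setD1 c). Qed.

(** It suffices that the free neighbours number at most [d.-1 * #|L|.-1]. For four leaves the bound
    1 + 8 is attained by [3 * 3] at [d = 4]. For six or more leaves, three per leaf are affordable
    because the centre forces [#|L| <= d]. *)
Lemma charge_star5 : #|B| != 3 -> charge B <= d * d.-1 * size_bound B.
Proof.
move=> B3; apply: leq_trans (charge_le B) _; rewrite -mulnA leq_mul2l; apply/orP; right.
rewrite sum_free_split size_bound_star; have c1 := center_free.
have [B5|nB5] := eqVneq #|B| 5.
  have L4 : #|L| = 4 by move: B5; rewrite cardB => -[].
  suff L8 : \sum_(v in L) #|N v| <= 8.
    by rewrite L4; move: L8 c1 d_ge4; clear; lia.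
  have [v /andP[Lv Nv]|small] := pickP [pred v in L | 3 <= #|N v|].
    rewrite (big_setD1 v) //=.
    have : \sum_(u in L :\ v) #|N u| <= \sum_(u in L :\ v) 1.
      apply: leq_sum => u /setD1P[nuv Lu]; rewrite leqNgt; apply/negP.
      by apply: (two_leaves B5 Lv Lu); rewrite // eq_sym.
    rewrite sum1_card; have := leaf_free4 B3 Lv; move: (cardsD1 v L); rewrite Lv L4.
    by clear; lia.
  apply: leq_trans (_ : \sum_(v in L) 2 <= _); last by rewrite sum_nat_const L4.
  by apply: leq_sum => v Lv; have := small v; rewrite /= Lv /= => /negbT; rewrite -leqNgt.
have L6 : 6 <= #|L|.
  by move: B3 nB5 L_ge2 evL; rewrite cardB; case: #|_| => [|[|[|[|[|[|]]]]]].
have Ld : #|L| <= d.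
  by rewrite -(degE c); apply: subset_leq_card; apply/subsetP=> v Lv; rewrite inE ecL.
have : \sum_(v in L) #|N v| <= \sum_(v in L) 3.
  by apply: leq_sum => v Lv; apply: leaf_free4.
by rewrite sum_nat_const; move: c1 L6 Ld; clear; nia.
Qed.
End Star.

Lemma two_paths B p q r s t u : B \in P -> all (mem (B :|: R)) [:: p; q; r; s; t; u] ->
  uniq [:: p; q; r; s; t; u] -> e q p -> e q r -> e t s -> e t u -> 8 <= value B.
Proof.
move=> BP /=; rewrite andbT => /and5P[sp sq sr ss /andP[st su]].
rewrite !in_cons !in_nil !orbF !negb_or -!andbA.
case/and5P=> _ npr nps npt /and5P[npu _ nqs nqt /and5P[nqu nrs nrt nru /and3P[_ nsu _]]].
move=> eqp eqr ets etu; have := value_path npr eqp eqr; have := value_path nsu ets etu.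
have := @exchange2 B [set p; q; r] [set s; t; u] BP.
rewrite !subUset !sub1set /= sp sq sr ss st su => /(_ isT isT) le v1 v2.
apply: leq_trans (leq_add v2 v1) (le _).
rewrite !disjoint_setU !disjoints1 !inE !negb_or.
by rewrite nps npt npu nqs nqt nqu nrs nrt nru.
Qed.

Lemma big_star B c x y z w : B \in P -> all (mem (B :|: R)) [:: c; x; y; z; w] ->
  uniq [:: x; y; z; w] -> e c x -> e c y -> e c z -> e c w -> 8 <= value B.
Proof.
move=> BP /=; rewrite andbT => /and5P[sc sx sy sz sw] u ex ey ez ew.
apply: leq_trans (value_star4 u ex ey ez ew) (exchange1 BP _).
by rewrite !subUset !sub1set /= sc sx sy sz sw.
Qed.

Ltac distinct := rewrite /= ?in_cons ?in_nil ?orbF ?negb_or ?andbT;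
  repeat (apply/andP; split);
  match goal with H : is_true (?x != ?y) |- is_true (?x != ?y) => exact: H
                | H : is_true (?x != ?y) |- is_true (?y != ?x) => by rewrite eq_sym
                | |- _ => done end.

Lemma path_facts a b c : a != c -> e b a -> e b c ->
  [/\ odd #|[set a; b; c]|, #|[set a; b; c]| = 3, ~~ K23 [set a; b; c] &
      forall v, v \in [set a; b; c] -> v != b -> e b v].
Proof.
move=> nac eba ebc.
have nab : a != b by apply: contraTneq eba => ->; rewrite e0.
have nbc : b != c by apply: contraTneq ebc => ->; rewrite e0.
have B3 : #|[set a; b; c]| = 3 by rewrite -setUA cardsU1 cards2 !inE negb_or nab nac nbc.
split; rewrite ?B3 ?/K23 ?B3 // => v; rewrite !inE -orbA.
by case/or3P=> /eqP->; rewrite ?eqxx.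
Qed.

(** With at most three edges to free vertices the load bound [d] suffices. The exchanges leave one
    case with four, two at [a] and one each at [b] and [c]; there all the free ends are isolated
    among the free vertices, so the charge is [4 * d.-1], within the bound because [4 <= d]. *)
Lemma charge_path_end a b c : [set a; b; c] \in P -> a != c -> e b a -> e b c ->
  2 <= #|N a| -> charge [set a; b; c] <= d * d.-1.
Proof.
move=> BP nac eba ebc a2; have [oB B3 nK ebB] := path_facts nac eba ebc.
set B := [set a; b; c] in BP oB B3 nK ebB *.
have nab : a != b by apply: contraTneq eba => ->; rewrite e0.
have nbc : b != c by apply: contraTneq ebc => ->; rewrite e0.
have [Ba Bb Bc] : [/\ a \in B, b \in B & c \in B] by rewrite !inE !eqxx !orbT.
have mB v : v \in B -> v \in B :|: R by move=> Bv; apply/setUP; left.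
have mR v : v \in R -> v \in B :|: R by move=> Rv; apply/setUP; right.
have [ma mb mc] := And3 (mB a Ba) (mB b Bb) (mB c Bc).
have b1 : #|N b| <= 1 := center_free BP nK oB Bb ebB.
have [La Lc] : a \in B :\ b /\ c \in B :\ b by rewrite !in_setD1 nab Ba Bc eq_sym nbc.
have {a2} a2 : #|N a| = 2.
  by apply/eqP; rewrite eqn_leq a2 andbT; apply: (leaf_free3 BP nK Bb ebB B3 La).
have c2 : #|N c| <= 2 by apply: (leaf_free3 BP nK Bb ebB B3 Lc).
(* In a triangle [a] is a centre as well, and a centre has at most one free neighbour. *)
have nT : ~~ triangle B.
  apply/negP=> /andP[_ /forall_inP/(_ a Ba)/joinedP[_ ja]].
  suff : #|N a| <= 1 by rewrite a2.
  by apply: (center_free BP nK oB Ba) => v Bv nva; apply: ja; rewrite ?in_set1.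
have vB : value B < 5.
  rewrite /value (negbTE nK) B3; case: ifP => // _.
  by rewrite (negbTE nT).
have no8 : ~ (8 <= value B) by move: vB; clear; lia.
have sumE : \sum_(v in B) #|N v| = #|N a| + #|N b| + #|N c|.
  by rewrite (big_setD1 a) //= /B -setUA setU1K ?(big_setU1 _ _ (A := [set c])) ?big_set1 ?addnA // !inE ?negb_or ?nab ?nac.
have fewer : #|N b| + #|N c| <= 1 -> charge B <= d * d.-1.
  move=> le1; apply: leq_trans (charge_le B) _; rewrite leq_mul2l; apply/orP; right.
  by rewrite sumE a2; move: le1 d_ge4; clear; lia.
have /eqP/cards2P[x0 [y0 [nxy0 Na0]]] := a2.
(* Otherwise [z] completes a path on [b] and [c], disjoint from the path centred at [a]: total value
   8. *)
have inx z : z \in N b \/ z \in N c -> z \in N a.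
  move=> Nz; apply/negP=> /negP nz; apply: no8; rewrite Na0 in nz.
  move: nz; rewrite in_set2 negb_or => /andP[nzx nzy].
  have [] : (x0 \in N a) /\ (y0 \in N a) by rewrite Na0 !inE !eqxx orbT.
  rewrite !NP => /andP[eax Rx] /andP[eay Ry].
  have Rz : z \in R by case: Nz; rewrite NP => /andP[].
  have nB v w : v \in B -> w \in R -> v != w by apply: block_free.
  have := (nB a x0 Ba Rx, nB a y0 Ba Ry, nB b x0 Bb Rx, nB b y0 Bb Ry, nB c x0 Bc Rx, nB c y0 Bc Ry).
  move=> [[[[[n1 n2] n3] n4] n5] n6]; have := (nB a z Ba Rz, nB b z Bb Rz, nB c z Bc Rz).
  move=> [[n7 n8] n9].
  case: Nz; rewrite NP => /andP[ez _].
    apply: (@two_paths B x0 a y0 c b z) => //; last distinct.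
    by rewrite /= ma mb mc !mR.
  apply: (@two_paths B x0 a y0 b c z) => //; last by rewrite eC.
    by rewrite /= ma mb mc !mR.
  distinct.
(* With two free neighbours, [c] shares them with [a], and [a], [c] against [b |: N a] is a
   K_{2,3}. *)
have c1 : #|N c| <= 1.
  rewrite leqNgt; apply/negP=> c_gt1; apply: no8.
  have NcE : N c = N a.
    apply/eqP; rewrite eqEcard a2 c_gt1 andbT; apply/subsetP=> z Nz.
    by apply: inx; right.
  have bN : b \notin N a.
    by apply/negP; rewrite NP => /andP[_ /(block_free BP Bb)]; rewrite eqxx.
  have : value ([set a; c] :|: (b |: N a)) <= value B.
    apply: exchange1 => //; rewrite !subUset !sub1set ma mb mc /=.
    by apply: subset_trans (subsetIr _ _) (subsetUr _ _).
  rewrite value_K23 ?cards2 ?nac ?cardsU1 ?bN ?a2 // => [|u v]; first by move/(leq_trans _)->.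
  rewrite in_set2 in_setU1 => /orP[]/eqP-> /predU1P[->|]; rewrite 1?eC //.
    by rewrite NP eC => /andP[].
  by rewrite -NcE NP eC => /andP[].
have [le1|] := leqP (#|N b| + #|N c|) 1; first exact: fewer.
move=> gt1; have [/eqP/cards1P[x Nb] /eqP/cards1P[z Nc]] : #|N b| = 1 /\ #|N c| = 1.
  by move: gt1 b1 c1; clear; lia.
have Nax : x \in N a by apply: inx; left; rewrite Nb inE.
have [y nyx Na] : exists2 y, y != x & N a = [set x; y].
  move: Nax; rewrite Na0 in_set2 => /orP[]/eqP->; first by exists y0; rewrite // eq_sym.
  by exists x0; rewrite // setUC.
have [] : [/\ x \in N a, y \in N a, x \in N b & z \in N c] by rewrite Na Nb Nc !inE !eqxx orbT.
rewrite !NP => /andP[eax Rx] /andP[eay Ry] /andP[ebx _] /andP[ecz Rz].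
have nB v w : v \in B -> w \in R -> v != w by apply: block_free.
have := (nB a x Ba Rx, nB a y Ba Ry, nB b x Bb Rx, nB b y Bb Ry, nB c x Bc Rx, nB c y Bc Ry).
move=> [[[[[n1 n2] n3] n4] n5] n6].
(* The extra unit of triangles is used here: the triangle on [a], [x], [y] would beat the path
   [B]. *)
have nexy : ~~ e x y.
  apply/negP=> exy; suff : 5 <= value B by rewrite leqNgt vB.
  apply: leq_trans (value_triangle eax exy eay) (exchange1 BP _).
  by rewrite !subUset !sub1set ma !mR.
have zxy : z = x \/ z = y.
  have : z \in N a by apply: inx; right; rewrite Nc inE.
  by rewrite Na in_set2 => /orP[]/eqP; [left|right].
(* A free neighbour [w] of [x] or [y] yields a star with four leaves at [x] or two disjoint paths on
   the six vertices, according to whether [z] is [x] or [y]. *)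
have iso w : w \in R -> ~~ e x w /\ ~~ e y w.
  move=> Rw; have := (nB a w Ba Rw, nB b w Bb Rw, nB c w Bc Rw) => -[[m1 m2] m3].
  have [->|nwx] := eqVneq w x; first by rewrite e0 eC nexy.
  have [->|nwy] := eqVneq w y; first by rewrite e0 nexy.
  have sub s : all (mem [:: a; b; c; x; y; w]) s -> all (mem (B :|: R)) s.
    apply: sub_all => v /=; rewrite !in_cons in_nil orbF.
    by case/or4P=> [/eqP->|/eqP->|/eqP->|/or3P[]/eqP->] //; apply: mR.
  split; apply/negP=> ew; apply: no8; case: zxy => Ez; rewrite Ez in ecz.
  - by apply: (@big_star B x a b c w); rewrite ?sub //= ?inE ?eqxx ?orbT 1?eC //; distinct.
  - apply: (@two_paths B w x b a y c); rewrite ?sub //= ?inE ?eqxx ?orbT 1?eC //; distinct.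
  - apply: (@two_paths B w y a x b c); rewrite ?sub //= ?inE ?eqxx ?orbT 1?eC //; distinct.
  apply: (@two_paths B w y c x a b); rewrite ?sub //= ?inE ?eqxx ?orbT 1?eC //; distinct.
have loadE v : v = x \/ v = y -> load v = d.-1.
  move=> vxy; rewrite /load; suff -> : N v = set0 by rewrite eqxx.
  apply/setP=> w; rewrite NP in_set0; apply/negP=> /andP[evw /iso[]].
  by case: vxy evw => -> ->.
have -> : charge B = \sum_(v in B) #|N v| * d.-1.
  apply: eq_bigr => v Bv; rewrite -sum_nat_const; apply: eq_bigr => w Nw; apply: loadE.
  have : w \in N a.
    move: Bv Nw; rewrite !in_setU !in_set1 => /orP[/orP[]|] /eqP-> // Nw; apply: inx; [by left|by right].
  by rewrite Na in_set2 => /orP[]/eqP; [left|right].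
rewrite -big_distrl /= sumE a2 Nb Nc !cards1; rewrite leq_mul2r; apply/orP; right.
exact: d_ge4.
Qed.

Lemma charge_path a b c : [set a; b; c] \in P -> a != c -> e b a -> e b c ->
  charge [set a; b; c] <= d * d.-1.
Proof.
move=> BP nac eba ebc; have swapE : [set a; b; c] = [set c; b; a].
  by apply/setP=> v; rewrite !inE; case: (v == a); case: (v == b); case: (v == c).
have [a2|a1] := leqP 2 #|N a|; first exact: charge_path_end.
have [c2|c1] := leqP 2 #|N c|.
  by rewrite swapE; apply: charge_path_end; rewrite -?swapE // eq_sym.
have [oB B3 nK ebB] := path_facts nac eba ebc.
have Bb : b \in [set a; b; c] by rewrite !inE eqxx orbT.
have b1 : #|N b| <= 1 := center_free BP nK oB Bb ebB.
apply: leq_trans (charge_le _) _; rewrite leq_mul2l; apply/orP; right.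
apply: leq_trans (_ : \sum_(v in [set a; b; c]) 1 <= _).
  by apply: leq_sum => v; rewrite !in_setU !in_set1 => /orP[/orP[]|] /eqP->.
by rewrite sum1_card B3; move: d_ge4; clear; lia.
Qed.

Lemma block_cases B : B \in P -> K23 B \/
  [/\ ~~ K23 B, odd #|B|, 1 < #|B| & exists2 c, c \in B & forall v, v \in B -> v != c -> e c v].
Proof.
move=> BP; have [|nK] := boolP (K23 B); [by left|right].
have /andP[_ /forall_inP/(_ B BP)] := packP.
rewrite /value (negbTE nK); case: ifP => // /and3P[oB B1 /existsP[c /joinedP[cB jc]]] _.
split=> //; exists c; first by rewrite -sub1set.
by move=> v Bv nv; apply: jc; rewrite ?in_set1.
Qed.

Lemma charge_block B : B \in P -> charge B <= d * d.-1 * size_bound B.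
Proof.
move=> BP; have [kB|[nK oB B1 [c Bc ecB]]] := block_cases BP; first exact: charge_K23.
have [B3|B3] := eqVneq #|B| 3; last exact: (charge_star5 BP nK oB B1 Bc ecB B3).
have cL : #|B :\ c| = 2 by move: B3; rewrite (cardsD1 c) Bc => -[].
rewrite (size_bound_star nK Bc) cL muln1.
have /eqP/cards2P[a [a' [naa' LE]]] := cL.
have BE : B = [set a; c; a'].
  by rewrite -(setD1K Bc) LE; apply/setP=> v; rewrite !inE orbA [(v == c) || _]orbC.
have [/setD1P[nac Ba] /setD1P[na'c Ba']] : a \in B :\ c /\ a' \in B :\ c.
  by rewrite LE !inE !eqxx orbT.
by rewrite BE; apply: charge_path; rewrite -?BE ?ecB.
Qed.

Lemma order_le_blocks :
  #|T| <= \sum_(B in P) (if K23 B then 6 else #|B|.-1) * 2.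
Proof.
have D_gt0 : 0 < d * d.-1 by move: d_ge4; clear; case: d => [|[]].
have leR : #|R| <= \sum_(B in P) size_bound B.
  rewrite -(leq_pmul2r D_gt0) -sum_charge mulnC big_distrr /=.
  exact: leq_sum charge_block.
rewrite -(cardsC (cover P)) -/R.
have /andP[/eqP <- _] := packP.
apply: leq_trans (leq_add (leqnn _) leR) _; rewrite -big_split /=.
apply: leq_sum => B BP; rewrite subnKC //.
have [kB|[nK _ B1 _]] := block_cases BP.
  by rewrite kB; case/andP: kB => /eqP->.
by rewrite (negbTE nK); move: B1; clear; lia.
Qed.
End Charges.
End Maximal.
End Blocks.

(** * Line graphs *)

Section LineGraph.
Variables (T : finType) (e M : rel T).
Hypotheses (e0 : irreflexive e) (MC : symmetric M) (Me : subrel M e).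
Hypothesis odd_ends : forall x y, M x y -> odd (deg M x + deg M y).

Let M_neq x y : M x y -> x != y.
Proof. by apply: contraTneq => ->; apply/negP=> /Me; rewrite e0. Qed.

Lemma edgesP A : reflect (exists x y, M x y /\ A = [set x; y]) (A \in edges M).
Proof.
apply: (iffP imset2P) => [[x y _]|[x [y [Mxy ->]]]].
  by rewrite inE => /andP[_ Mxy] ->; exists x, y.
by exists x y; rewrite // inE.
Qed.

Lemma set2_inj (x : T) : injective (fun z => [set x; z]).
Proof.
move=> y z E; have : y \in [set x; z] by rewrite -E !inE eqxx orbT.
rewrite !inE => /orP[/eqP Ey|/eqP//].
have : z \in [set x; y] by rewrite E !inE eqxx orbT.
by rewrite Ey !inE orbb => /eqP->.
Qed.
Arguments set2_inj x [x1 x2].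

(** The edges adjacent to [[set x; y]] split into those at [x] and those at [y]; the edge itself is
    counted once in each degree, whence the 2. *)
Lemma card_adjacent_edges x y : M x y ->
  (#|[set A in edges M | (A != [set x; y]) && (A :&: [set x; y] != set0)]|).+2
    = deg M x + deg M y.
Proof.
move=> Mxy; have nxy := M_neq Mxy.
have -> : [set A in edges M | (A != [set x; y]) && (A :&: [set x; y] != set0)] =
    (fun z => [set x; z]) @: (nbhd M x :\ y) :|: (fun z => [set y; z]) @: (nbhd M y :\ x).
  apply/setP=> A; rewrite in_set in_setU; apply/and3P/orP.
    case=> /edgesP[u [v [Muv ->]]] nA /set0Pn[w]; rewrite !inE => /andP[wuv wxy].
    have {wuv} [z Mwz AE] : exists2 z, M w z & [set u; v] = [set w; z].
      by case/orP: wuv => /eqP->; [exists v | exists u; rewrite 1?MC // setUC].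
    rewrite AE in nA *; case/orP: wxy => /eqP Ew; rewrite Ew in Mwz nA *; [left|right].
      apply/imsetP; exists z => //; rewrite !inE Mwz andbT.
      by apply: contraNneq nA => ->.
    apply/imsetP; exists z => //; rewrite !inE Mwz andbT.
    by apply: contraNneq nA => ->; rewrite setUC.
  have nz (u v z : T) : z != v -> [set u; z] != [set u; v].
    by move=> nzv; apply: contraNneq nzv => /(set2_inj u)->.
  case=> /imsetP[z]; rewrite !inE => /andP[nz' Mz] ->.
    split; [by apply/edgesP; exists x, z | exact: nz |].
    by apply/set0Pn; exists x; rewrite !inE eqxx.
  split; [by apply/edgesP; exists y, z | by rewrite (setUC [set x]); apply: nz |].
  by apply/set0Pn; exists y; rewrite !inE eqxx orbT.
rewrite cardsU !card_imset; try exact: set2_inj.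
rewrite (_ : _ :&: _ = set0) ?cards0 ?subn0; last first.
  apply/setP=> A; rewrite inE [RHS]inE; apply/andP=> -[/imsetP[z]].
  rewrite !inE => /andP[nzy _] -> /imsetP[z' /setD1P[nz'x _]] E.
  have : x \in [set y; z'] by rewrite -E !inE eqxx.
  by rewrite !inE (negbTE nxy) eq_sym (negbTE nz'x).
rewrite /deg (cardsD1 y (nbhd M x)) (cardsD1 x (nbhd M y)).
by rewrite !inE Mxy -(MC x y) Mxy !add1n addSn addnS.
Qed.

Lemma sum_deg_edges : \sum_x deg M x = #|edges M| * 2.
Proof.
have -> : \sum_x deg M x = \sum_(p : T * T | M p.1 p.2) 1.
  rewrite -(pair_big_dep xpredT (fun x y => M x y) (fun _ _ => 1)) /=.
  by apply: eq_bigr => x _; rewrite sum1dep_card.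
rewrite (partition_big (fun p => [set p.1; p.2]) (mem (edges M))) /=; last first.
  by move=> [x y] /= Mxy; apply/edgesP; exists x, y.
rewrite -sum_nat_const; apply: eq_bigr => A /edgesP[x [y [Mxy ->]]].
have nxy := M_neq Mxy; rewrite sum1dep_card.
have -> : [set p | M p.1 p.2 & [set p.1; p.2] == [set x; y]] = [set (x, y); (y, x)].
  apply/setP=> -[u v]; rewrite !inE /= !xpair_eqE; apply/andP/orP.
    case=> Muv /eqP E; have : u \in [set x; y] by rewrite -E !inE eqxx.
    rewrite !inE => /orP[]/eqP Eu; rewrite Eu in E *; [left|right]; rewrite eqxx.
      by rewrite (set2_inj x E) eqxx.
    by rewrite [RHS]setUC in E; rewrite (set2_inj y E) eqxx.
  by case=> /andP[/eqP-> /eqP->]; rewrite // 1?MC Mxy // setUC eqxx.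
by rewrite cards2 xpair_eqE negb_and nxy.
Qed.

(** Adjacency of edges depends only on the edges themselves, so the edges of [M] induce the line
    graph of [M] in that of [e], although [M] need not be induced in [e]. Its degrees,
    [deg M x + deg M y] minus 2, are odd. *)
Theorem line_graph_bound : \sum_x deg M x <= f_o (@line_rel T e) * 2.
Proof.
rewrite sum_deg_edges leq_mul2r /=.
have EM : edges M \subset edges e.
  apply/subsetP=> A /edgesP[x [y [Mxy ->]]].
  by apply/imset2P; exists x y; rewrite // inE Me.
pose S := [set a : line_vert e | val a \in edges M].
have cardS (Q : pred {set T}) : #|[set a in S | Q (val a)]| = #|[set A in edges M | Q A]|.
  rewrite -(card_imset _ val_inj); apply: eq_card => A; rewrite inE.
  apply/imsetP/andP => [[a]|[AM QA]].
    by rewrite !inE => /andP[aM Qa] ->.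
  by exists (exist _ A (subsetP EM A AM)); rewrite // !inE /= AM.
have -> : #|edges M| = #|S|.
  have := cardS predT; rewrite (_ : [set a in S | _] = S); last by apply/setP=> a; rewrite !inE andbT.
  by move=> ->; apply: eq_card => A; rewrite !inE andbT.
apply: (@leq_bigmax_cond _ (odd_induced (@line_rel T e)) (fun S : {set line_vert e} => #|S|)).
apply/forall_inP=> a; rewrite inE => /edgesP[x [y [Mxy ax]]].
have -> : #|[set u in S | line_rel a u]| =
    #|[set A in edges M | (A != [set x; y]) && (A :&: [set x; y] != set0)]|.
  rewrite -cardS; apply: eq_card => b; rewrite !inE /line_rel ax.
  by rewrite [_ == val b]eq_sym setIC.
have := odd_ends Mxy; rewrite -(card_adjacent_edges Mxy) /=.
by rewrite negbK.
Qed.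
End LineGraph.

(** * From a packing to an odd induced subgraph of the line graph *)

Section Assembly.
Variables (T : finType) (e : rel T) (d : nat).
Hypotheses (eC : symmetric e) (e0 : irreflexive e).
Hypotheses (d_ge4 : 4 <= d) (degE : forall v, deg e v = d).

Lemma large_packing : exists2 P, packing e P &
  #|T| <= \sum_(B in P) (if K23 e B then 6 else #|B|.-1) * 2.
Proof.
have pack0 : packing e set0.
  apply/andP; split; first by apply/trivIsetP=> B1 B2; rewrite inE.
  by apply/forall_inP=> B; rewrite inE.
case: (arg_maxnP (packing_value e) pack0) => P packP maxP; exists P => //.
by apply: (order_le_blocks eC e0 packP _ d_ge4 degE) => P' /maxP.
Qed.

Lemma spanning_bipartite P B : packing e P -> B \in P -> exists D : {set T},
  [/\ odd #|B|, joined e D B & #|D| * #|B :\: D| = if K23 e B then 6 else #|B|.-1].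
Proof.
move=> packP BP; have [kB|[nK oB B1 [c Bc ecB]]] := block_cases packP BP.
  rewrite kB; case/andP: kB => /eqP B5 /existsP[D /andP[/eqP D2 jD]].
  exists D; split; rewrite ?B5 //; case/joinedP: jD => DB _.
  by rewrite cardsD (setIidPr DB) B5 D2.
exists [set c]; split=> //.
  apply/joinedP; split=> [|x y]; first by rewrite sub1set.
  by rewrite !inE => /eqP-> By nyc; apply: ecB.
by rewrite (negbTE nK) cards1 mul1n (cardsD1 c B) Bc.
Qed.

Theorem line_graph_half : #|T| <= f_o (@line_rel T e) * 2.
Proof.
have [P packP leT] := large_packing; apply: leq_trans leT _.
have /fin_all_exists[D DP] B : exists D : {set T}, B \in P ->
    [/\ odd #|B|, joined e D B & #|D| * #|B :\: D| = if K23 e B then 6 else #|B|.-1].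
  have [BP|nBP] := boolP (B \in P); last by exists set0.
  by have [D DP] := spanning_bipartite packP BP; exists D.
have tP : trivIset P by case/andP: packP.
(* Only edges across a block are kept, so the degrees at the two ends of an edge are the sizes of
   the two sides, which add up to the odd order of the block. *)
pose M x y := [exists B in P, [&& x \in B, y \in B & (x \in D B) != (y \in D B)]].
have ME B x y : B \in P -> x \in B -> M x y = (y \in B) && ((x \in D B) != (y \in D B)).
  move=> BP Bx; apply/exists_inP/idP => [[B' B'P /and3P[B'x B'y nD]]|].
    have <- : B' = B by rewrite -(def_pblock tP BP Bx) (def_pblock tP B'P B'x).
    by rewrite B'y.
  by move=> yB; exists B; rewrite // Bx.
have MC : symmetric M.
  suff sub x y : M x y -> M y x by move=> x y; apply/idP/idP; apply: sub.
  case/exists_inP=> B BP /and3P[Bx By nD]; apply/exists_inP; exists B => //.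
  by rewrite Bx By eq_sym.
have Me : subrel M e.
  move=> x y /exists_inP[B BP /and3P[Bx By nD]].
  have [_ /joinedP[_ jD] _] := DP B BP.
  by move: nD; case Dx: (x \in D B); case Dy : (y \in D B) => // _;
    [|rewrite eC]; apply: jD; rewrite ?Dx ?Dy.
have degM B x : B \in P -> x \in B -> deg M x = if x \in D B then #|B :\: D B| else #|D B|.
  move=> BP Bx; have [_ /joinedP[DB _] _] := DP B BP.
  rewrite /deg; case: ifP => Dx; apply: eq_card => y; rewrite !inE (ME B) // Dx.
    by rewrite andbC; case: (y \in D B).
  by case Dy: (y \in D B); rewrite ?andbF // (subsetP DB).
apply: leq_trans (line_graph_bound e0 MC Me _).
  apply: leq_trans (_ : \sum_(x in cover P) deg M x <= _); last first.
    by rewrite [leqLHS]big_mkcond; apply: leq_sum => x _; case: ifP.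
  rewrite big_trivIset //=; apply: leq_sum => B BP.
  have [_ /joinedP[DB _] <-] := DP B BP.
  rewrite (big_setID (D B)) /= (setIidPr DB).
  rewrite (eq_bigr (fun=> #|B :\: D B|)); last first.
    by move=> x Dx; rewrite (degM B) ?Dx // (subsetP DB).
  rewrite [X in _ + X](eq_bigr (fun=> #|D B|)); last first.
    by move=> x /setDP[Bx Dx]; rewrite (degM B) // (negbTE Dx).
  by rewrite !sum_nat_const [X in _ + X]mulnC addnn muln2.
move=> x y /exists_inP[B BP /and3P[Bx By nD]].
have [oB /joinedP[DB _] _] := DP B BP.
have oS : odd (#|D B| + #|B :\: D B|) by rewrite -{1}(setIidPr DB) cardsID.
rewrite (degM B x) // (degM B y) //; move: nD oS.
by case: (x \in D B); case: (y \in D B) => //; rewrite addnC.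
Qed.
End Assembly.

(** For even [d] the gadget is applied to the whole vertex set, which has no boundary; every edge
    cut is then even, so none consists of one edge. *)
Lemma exists_2_3_factor (T : finType) (e : rel T) d :
  symmetric e -> irreflexive e -> 4 <= d -> (forall v, deg e v = d) ->
  exists h : rel T,
  [/\ symmetric h, subrel h e, forall v, deg h v = 2 \/ deg h v = 3 &
      forall v u, h v u -> deg h v = deg h u].
Proof.
move=> eC e0 d4 degE; case od : (odd d).
  have degE' v : deg e v = d \/ deg e v = 0 by left.
  have [h [hC he h23 hh]] := regular_2_3_factor eC e0 (ltnW d4) od degE'.
  by exists h; split=> // v; apply: h23.
have degT v : v \in [set: T] -> deg e v = d by [].
have bT : boundary e [set: T] = set0 by apply/setP=> -[v u]; rewrite !inE.
have [||||F [F2 Fe FC _]] := @two_factor T e setT d eC e0 d4 degT set0.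
- exact: sub0set.
- by rewrite bT cards0.
- move=> A _ _; apply: contraFneq od => A1.
  have := odd_boundary (A := A) eC e0 (fun v _ => degE v).
  by rewrite A1 oddM => /esym/andP[].
- by rewrite bT cards0.
exists F; split=> [v u|v u /Fe[]//|v|v u _].
- by rewrite FC ?inE.
- by left; rewrite -(F2 v) // inE.
by rewrite /deg /nbhd !F2 ?inE.
Qed.

Theorem theorem3p3 (T : finType) (e : rel T) (d : nat) :
  simple_graph e ->
  (4 <= d)%N ->
  (forall v : T, deg e v = d) ->
  exists h : rel T,
    [/\ simple_graph h,
        subrel h e,
        (forall C, C \in components h -> cycle_comp h C \/ cubic_comp h C) &
        ((#|T|%:R / 2 - (C5 h)%:R / 2 : rat) <= (f_o (@line_rel T e))%:R)%R].
Proof.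
move=> [eC e0] d_ge4 degE.
have [h [hC he h23 hh]] := exists_2_3_factor eC e0 d_ge4 degE.
exists h; split=> // [|C /imsetP[x _ ->]|].
- by split=> // v; apply: contraFF (e0 v); apply: he.
- have deg_x y : connect h x y -> deg h y = deg h x.
    move=> cxy; have cl : closed h [pred z | deg h z == deg h x].
      by move=> u v /hh; rewrite !inE => ->.
    by have := closed_connect cl cxy; rewrite !inE eqxx => /esym/eqP.
  by case: (h23 x) => dx; [left|right]; apply/forall_inP=> y; rewrite inE => /deg_x->; rewrite dx.
have := line_graph_half eC e0 d_ge4 degE.
rewrite -(ler_nat rat) natrM => le_fo.
apply: le_trans (_ : (#|T|%:R / 2 <= _)%R); last by rewrite ler_pdivrMr.
by rewrite gerBl divr_ge0.
Qed.
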